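(* Let $F$ be a field with $\mathrm{char}\,F=2$, let $Q$ be a Hurwitz algebra over $F$ of dimension $2$ or $4$, let $0\neq\alpha\in F$, and consider the Hurwitz superalgebra $C=\mathrm{CD}(Q,\alpha)$ (so $C_{\bar0}=Q$). Let $\Gamma:C=\bigoplus_{g\in G}C^g$ be a fine grading on the superalgebra $C$, where $G$ is its universal grading group. Write $C_i^g=C^g\cap C_i$ for $i=\bar0,\bar1$. Then, up to equivalence, one of the following cases holds. $\bullet$ If $\dim Q=2$ ($\dim C=4$), then either: (i) $G=\mathbb{Z}_2$, $Q=C_{\bar0}$ is not split and $\Gamma$ is the main grading; or (ii) $G=\mathbb{Z}$ ($3$-grading), $Q=C_{\bar0}$ is split, and there is a canonical basis $\{e_1,e_2,u_1,v_1\}$ of $C$ consisting of homogeneous elements such that $$C_{\bar0}^0=Q=\mathrm{span}\{e_1,e_2\},\quad C_{\bar1}^1=\mathrm{span}\{u_1\},\quad C_{\bar1}^{-1}=\mathrm{span}\{v_1\}.$$ $\bullet$ If $\dim Q=4$ ($\dim C=8$), then one of the following holds: (i) $G=\mathbb{Z}_2^2$, $C_{\bar0}^{(\bar0,\bar0)}$ is not split, and $\Gamma$ is a refinement of the main $\mathbb{Z}_2$-grading associated to a Cayley–Dickson doubling process as follows: $C=Q\oplus Qu$, $Q=K\oplus Kv$, $K=F1+Fw$ with $u,v,w$ nonisotropic orthogonal elements with zero trace, and $$C_{\bar0}^{(\bar0,\bar0)}=K,\quad C_{\bar0}^{(\bar1,\bar0)}=Kv,\quad C_{\bar1}^{(\bar0,\bar1)}=Ku,\quad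 C_{\bar1}^{(\bar1,\bar1)}=K(vu).$$ (ii) $G=\mathbb{Z}^2$, $Q=C_{\bar0}$ is split, there is a canonical basis of $C$ consisting of homogeneous elements with $C_{\bar0}=\mathrm{span}\{e_1,e_2,u_3,v_3\}$, $C_{\bar1}=\mathrm{span}\{u_1,u_2,v_1,v_2\}$, and $\Gamma$ is the Cartan $\mathbb{Z}^2$-grading: $$C_{\bar0}^{(0,0)}=\mathrm{span}\{e_1,e_2\},\; C_{\bar0}^{(1,1)}=\mathrm{span}\{v_3\},\; C_{\bar0}^{(-1,-1)}=\mathrm{span}\{u_3\},$$ $$C_{\bar1}^{(1,0)}=\mathrm{span}\{u_1\},\; C_{\bar1}^{(-1,0)}=\mathrm{span}\{v_1\},\; C_{\bar1}^{(0,1)}=\mathrm{span}\{u_2\},\; C_{\bar1}^{(0,-1)}=\mathrm{span}\{v_2\}.$$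
   Context: Gradings. A grading by a group $G$ on an algebra $\mathcal A$ is a decomposition $\Gamma:\mathcal A=\bigoplus_{g\in G}\mathcal A^g$ into subspaces with $\mathcal A^g\mathcal A^h\subseteq\mathcal A^{gh}$; its support is $\{g:\mathcal A^g\neq0\}$. Its universal grading group is the group generated by the support subject to the relations $g_1g_2=g_3$ whenever $0\neq\mathcal A^{g_1}\mathcal A^{g_2}\subseteq\mathcal A^{g_3}$. A superalgebra is a $\mathbb{Z}_2$-graded algebra $\mathcal A=\mathcal A_{\bar0}\oplus\mathcal A_{\bar1}$; this is called the main grading. A grading on the superalgebra $\mathcal A$ is a group grading on the algebra $\mathcal A$ such that $\mathcal A^g=(\mathcal A^g\cap\mathcal A_{\bar0})\oplus(\mathcal A^g\cap\mathcal A_{\bar1})$ for all $g$. A grading $\Gamma$ refines $\Gamma'$ if every component of $\Gamma$ is contained in a component of $\Gamma'$; a grading on a superalgebra is fine if it admits no proper refinement among group gradings on the superalgebra. Two gradings are equivalent if there is an isomorphism of superalgebras (preserving the main grading) mapping each nonzero homogeneous component of the first onto a homogeneous component of the second. All groups considered are abelian (the support of a grading on these superalgebras always generates an abelian group). Hurwitz algebras. A Hurwitz algebra is a unital algebra over $F$ with a regular multiplicative quadratic form $q$ (the norm); its polar form is also denoted $q$, and $\bar x=q(x,1)1-x$. The trace of $x$ is $q(x,1)$. Orthogonality refers to the polar form; an element $x$ is nonisotropic if $q(x)\neq0$. A Hurwitz algebra is split if it has a nonzero $x$ with $q(x)=0$. Given a Hurwitz algebra $Q$ with norm $q$ and $0\ne\alpha\in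 F$, $\mathrm{CD}(Q,\alpha)=Q\oplus Qu$ has multiplication $(a+bu)(c+du)=(ac-\alpha\bar d b)+(da+b\bar c)u$ for $a,b,c,d\in Q$ and norm $q(a+bu)=q(a)+\alpha q(b)$. It is a superalgebra with even part $Q$ and odd part $Qu$. Canonical basis of a split Cayley ($8$-dimensional Hurwitz) algebra: a basis $\{e_1,e_2,u_1,u_2,u_3,v_1,v_2,v_3\}$ with (indices mod $3$) $e_i^2=e_i$, $e_1e_2=e_2e_1=0$, $e_1u_i=u_i=u_ie_2$, $e_2v_i=v_i=v_ie_1$, $e_2u_i=u_ie_1=e_1v_i=v_ie_2=0$, $u_iu_{i+1}=v_{i+2}=-u_{i+1}u_i$, $v_iv_{i+1}=u_{i+2}=-v_{i+1}v_i$, $u_i^2=v_i^2=0$, $u_iv_j=-\delta_{ij}e_1$, $v_iu_j=-\delta_{ij}e_2$. A canonical basis of the split quaternion ($4$-dimensional Hurwitz) algebra is a basis $\{e_1,e_2,u_1,v_1\}$ with the same multiplication rules.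
   Formalization: In case (i) for dim Q = 4, ''zero trace'' is required only of u and v, not of w: in characteristic 2 a zero-trace w would make 1 orthogonal to all of Q, contradicting regularity; regularity of the norm on K is stated instead. *)

(* Defs.v *)
From HB Require Import structures.
From mathcomp Require Import all_boot all_order all_algebra.

Set Implicit Arguments.
Unset Strict Implicit.
Unset Printing Implicit Defensive.

Import GRing.Theory.
Local Open Scope ring_scope.

(* Algebras are finite dimensional, and neither associative nor unital in
   general. *)
Record algebra (F : fieldType) := Algebra {
  acar :> vectType F;
  amul : {bilinear acar -> acar -> acar}
}.
Notation "x ** y" := (amul _ x y) (at level 40, left associativity).

Lemma amulPl (F : fieldType) (A : algebra F) (a : F) (x y z : A) :
  (a *: x + y) ** z = a *: (x ** z) + y ** z.
Proof. exact: linearPl. Qed.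

Lemma amulPr (F : fieldType) (A : algebra F) (a : F) (x y z : A) :
  z ** (a *: x + y) = a *: (z ** x) + z ** y.
Proof. exact: linearPr. Qed.

Lemma amul0x (F : fieldType) (A : algebra F) (x : A) : 0 ** x = 0.
Proof. exact: linear0l. Qed.

Lemma amulx0 (F : fieldType) (A : algebra F) (x : A) : x ** 0 = 0.
Proof. exact: linear0r. Qed.

(* For a subspace K and an element x, the subspace Kx = { kx | k in K }. *)
Definition mulv_elt (F : fieldType) (A : algebra F) (K : {vspace A}) (x : A) :
  {vspace A} := (linfun (applyr (@amul F A) x) @: K)%VS.

Section QuadraticForms.
Variables (F : fieldType) (V : vectType F) (q : V -> F).

Definition polar (x y : V) : F := q (x + y) - q x - q y.

Definition quadratic_form :=
  (forall (a : F) (x : V), q (a *: x) = a ^+ 2 * q x)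
  /\ bilinear_for *%R *%R polar.

Definition polar_radical (U : {vspace V}) (x : V) :=
  x \in U /\ (forall y, y \in U -> polar x y = 0).

(* Regularity of the restriction of q to U: the radical of the polar form has
   dimension at most 1, and q has no nontrivial zero on it.  The radical of
   dimension 1 is what allows a one-dimensional U in characteristic 2; when
   \dim U is even the polar form is nondegenerate on U. *)
Definition regular_on (U : {vspace V}) :=
  (forall x, polar_radical U x -> x != 0 -> q x != 0)
  /\ (forall x y, polar_radical U x -> polar_radical U y -> x != 0 ->
        exists c : F, y = c *: x).

Definition split_on (U : {vspace V}) :=
  exists x, [/\ x \in U, x != 0 & q x = 0].

Definition is_nonisotropic (x : V) := q x != 0.

Definition polar_orthogonal (x y : V) := polar x y = 0.

End QuadraticForms.

(* Grading groups are abelian and written additively. *)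
Section Gradings.
Variables (F : fieldType) (A : algebra F).

Definition is_grading (G : zmodType) (Gamma : G -> {vspace A}) :=
  [/\ forall x : A, exists s : seq G, x \in (\sum_(g <- s) Gamma g)%VS,
      forall (s : seq G) (x : G -> A), uniq s -> (forall g, x g \in Gamma g) ->
        \sum_(g <- s) x g = 0 -> forall g, g \in s -> x g = 0
    & forall (g h : G) (x y : A),
        x \in Gamma g -> y \in Gamma h -> x ** y \in Gamma (g + h)].

Definition in_support (G : zmodType) (Gamma : G -> {vspace A}) (g : G) : bool :=
  Gamma g != 0%VS.

Definition homogeneous (G : zmodType) (Gamma : G -> {vspace A}) (x : A) :=
  exists g : G, x \in Gamma g.

Definition refines (G H : zmodType) (Gamma : G -> {vspace A})
    (Gamma' : H -> {vspace A}) :=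
  forall g : G, exists h : H, (Gamma g <= Gamma' h)%VS.

Definition proper_refinement (G H : zmodType) (Gamma : G -> {vspace A})
    (Gamma' : H -> {vspace A}) :=
  refines Gamma Gamma' /\ ~ refines Gamma' Gamma.

(* The defining relation g1 + g2 = g3, read off from
   0 <> A^g1 A^g2 <= A^g3, of the universal grading group. *)
Definition support_relation (G : zmodType) (Gamma : G -> {vspace A})
    (g1 g2 g3 : G) :=
  (exists x y, [/\ x \in Gamma g1, y \in Gamma g2 & x ** y != 0])
  /\ (forall x y, x \in Gamma g1 -> y \in Gamma g2 -> x ** y \in Gamma g3).

(* G is the abelian group presented by the support of Gamma and the relations
   above: the support generates G, and every map from the support to an
   abelian group that respects the relations extends to a homomorphism. *)
Definition universal_grading_group (G : zmodType) (Gamma : G -> {vspace A}) :=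
  (forall g : G, exists (s : seq G) (c : G -> int),
     all (in_support Gamma) s /\ g = \sum_(h <- s) h *~ c h)
  /\ (forall (H : zmodType) (f : G -> H),
        (forall g1 g2 g3, support_relation Gamma g1 g2 g3 ->
           f g1 + f g2 = f g3) ->
        exists phi : {additive G -> H},
          forall g, in_support Gamma g -> phi g = f g).

End Gradings.

Definition isomorphic_groups (G H : zmodType) :=
  exists phi : {additive G -> H}, bijective phi.

(* The index set 'Z_2 is the group of order 2; the component main 0 is even
   and main 1 is odd. *)
Record superalgebra (F : fieldType) := Superalgebra {
  sbase :> algebra F;
  main : 'Z_2 -> {vspace sbase};
  main_grading : is_grading main
}.

Definition even_part (F : fieldType) (C : superalgebra F) : {vspace C} :=
  main C 0.
Definition odd_part (F : fieldType) (C : superalgebra F) : {vspace C} :=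
  main C 1.

Definition is_super_grading (F : fieldType) (C : superalgebra F) (G : zmodType)
    (Gamma : G -> {vspace C}) :=
  is_grading Gamma
  /\ (forall g,
        Gamma g = (Gamma g :&: even_part C + Gamma g :&: odd_part C)%VS).

Definition is_fine_grading (F : fieldType) (C : superalgebra F) (G : zmodType)
    (Gamma : G -> {vspace C}) :=
  is_super_grading Gamma
  /\ (forall (H : zmodType) (Gamma' : H -> {vspace C}),
        is_super_grading Gamma' -> ~ proper_refinement Gamma' Gamma).

Definition super_isomorphism (F : fieldType) (C D : superalgebra F)
    (psi : 'Hom(C, D)) :=
  [/\ bijective psi, forall x y, psi (x ** y) = psi x ** psi y
    & forall i, (psi @: main C i)%VS = main D i].

Definition equivalent_gradings (F : fieldType) (C D : superalgebra F)
    (G H : zmodType) (Gamma : G -> {vspace C}) (Delta : H -> {vspace D}) :=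
  exists psi : 'Hom(C, D), super_isomorphism psi
    /\ (forall g, in_support Gamma g -> exists h, (psi @: Gamma g)%VS = Delta h).

(* Up to equivalence, Gamma is a grading satisfying P whose universal grading
   group is H. *)
Definition up_to_equivalence (F : fieldType) (C : superalgebra F)
    (G : zmodType) (Gamma : G -> {vspace C}) (H : zmodType)
    (P : (H -> {vspace C}) -> Prop) :=
  isomorphic_groups G H
  /\ exists Gamma' : H -> {vspace C},
       [/\ is_super_grading Gamma', universal_grading_group Gamma',
           equivalent_gradings Gamma Gamma' & P Gamma'].

Record hurwitz (F : fieldType) := Hurwitz {
  hbase :> algebra F;
  hone : hbase;
  hnorm : hbase -> F;
  hone_neq0 : hone != 0;
  hmul1x : forall x, hone ** x = x;
  hmulx1 : forall x, x ** hone = x;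
  hnorm_quadratic : quadratic_form hnorm;
  hnorm_regular : regular_on hnorm fullv;
  hnormM : forall x y, hnorm (x ** y) = hnorm x * hnorm y
}.

Section CayleyDickson.
Variables (F : fieldType) (Q : hurwitz F) (alpha : F).

Definition hconj (x : Q) : Q := polar (@hnorm F Q) x (hone Q) *: hone Q - x.

(* The pair (a, b) stands for a + bu. *)
Definition cd_mul (x y : Q * Q) : Q * Q :=
  (x.1 ** y.1 - alpha *: (hconj y.2 ** x.2),
   y.2 ** x.1 + x.2 ** hconj y.1).

Lemma hconj_linear : linear hconj.
Proof.
move=> a x y; rewrite /hconj; have [_ [H _]] := hnorm_quadratic Q.
rewrite (H (hone Q)) /= scalerDl -scalerA scalerBr opprD.
by rewrite addrACA.
Qed.

HB.instance Definition _ :=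
  GRing.isLinear.Build F Q Q *:%R hconj hconj_linear.

Lemma cd_mul_bilinear : bilinear_for *:%R *:%R cd_mul.
Proof.
split=> z a x y; rewrite /cd_mul /=; congr pair => /=.
- by rewrite amulPr amulPl /= scalerDr scalerBr opprD addrACA !scalerA mulrC.
- by rewrite amulPr amulPl /= scalerDr addrACA.
- rewrite amulPr (linearP hconj) amulPl /= scalerDr scalerBr opprD addrACA.
  by rewrite !scalerA mulrC.
- by rewrite (linearP hconj) amulPr amulPl /= scalerDr addrACA.
Qed.

HB.instance Definition _ :=
  bilinear_isBilinear.Build F (Q * Q)%type (Q * Q)%type (Q * Q)%type *:%R *:%R
    cd_mul cd_mul_bilinear.

Definition cd_algebra : algebra F := @Algebra F (Q * Q)%type cd_mul.

(* The even part is Q, i.e. b = 0, and the odd part is Qu, i.e. a = 0. *)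
Definition cd_main (i : 'Z_2) : {vspace cd_algebra} :=
  if i == 0 then lker (linfun (@snd Q Q)) else lker (linfun (@fst Q Q)).

Lemma cd_mainE i (x : Q * Q) :
  (x \in (cd_main i : {vspace cd_algebra}))
  = (if i == 0 then x.2 == 0 else x.1 == 0).
Proof. by rewrite /cd_main; case: ifP => _; rewrite memv_ker lfunE. Qed.

Lemma cd_main_grading : is_grading cd_main.
Proof.
split.
- move=> [a b]; exists [:: 0; 1]; rewrite !big_cons big_nil addv0.
  have -> : (a, b) = (a, 0) + (0, b) :> cd_algebra.
    by congr pair => /=; rewrite ?addr0 ?add0r.
  by apply: memv_add; rewrite cd_mainE /= eqxx.
- move=> s x us xin s0 g gs.
  have E (f : {linear cd_algebra -> Q}) :
      (forall h, h != g -> f (x h) = 0) -> f (x g) = 0.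
    move=> f0; have := congr1 f s0; rewrite raddf0 raddf_sum (bigD1_seq g) //=.
    by rewrite big1 ?addr0.
  have xg := xin g; rewrite cd_mainE in xg.
  have Z (h : 'Z_2) : h != g -> (h == 0) = ~~ (g == 0).
    by case: h g {gs E xg} => [[|[|//]] ?] [[|[|//]] ?].
  have {}E : (if g == 0 then (x g).1 else (x g).2) = 0.
    case: ifP (Z) => g0 {}Z.
      apply: (E fst) => h /Z h0; have := xin h.
      by rewrite cd_mainE h0 => /eqP.
    apply: (E snd) => h /Z h0; have := xin h.
    by rewrite cd_mainE h0 => /eqP.
  case: (x g) E xg => a b /=.
  by case: ifP => _ -> /eqP ->.
- move=> g h x y; rewrite !cd_mainE /amul /= /cd_mul.
  case: g h => [[|[|//]] ?] [[|[|//]] ?] /= /eqP e1 /eqP e2;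
    rewrite ?e1 ?e2 ?(linear0 hconj) ?amul0x ?amulx0 ?scaler0;
    by rewrite ?subr0 ?addr0.
Qed.

Definition CD : superalgebra F := Superalgebra cd_main_grading.

Definition cd_norm (x : CD) : F :=
  let: (a, b) := (x : Q * Q) in hnorm a + alpha * hnorm b.

Definition cd_one : CD := (hone Q, 0) : Q * Q.

End CayleyDickson.

Definition canonical_quaternion_basis (F : fieldType) (C : algebra F)
    (e1 e2 u1 v1 : C) :=
  basis_of fullv [:: e1; e2; u1; v1]
  /\ [/\ [/\ e1 ** e1 = e1, e2 ** e2 = e2, e1 ** e2 = 0 & e2 ** e1 = 0],
         [/\ e1 ** u1 = u1, u1 ** e2 = u1, e2 ** v1 = v1 & v1 ** e1 = v1],
         [/\ e2 ** u1 = 0, u1 ** e1 = 0, e1 ** v1 = 0 & v1 ** e2 = 0]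
       & [/\ u1 ** u1 = 0, v1 ** v1 = 0, u1 ** v1 = - e1 & v1 ** u1 = - e2]].

(* The indices 1, 2, 3 of u and v are taken modulo 3, so that 3 = 0 in 'Z_3. *)
Definition canonical_cayley_basis (F : fieldType) (C : algebra F)
    (e1 e2 : C) (u v : 'Z_3 -> C) :=
  basis_of fullv [:: e1; e2; u 1; u 2; u 3; v 1; v 2; v 3]
  /\ [/\ [/\ e1 ** e1 = e1, e2 ** e2 = e2, e1 ** e2 = 0 & e2 ** e1 = 0],
         forall i,
           [/\ e1 ** u i = u i, u i ** e2 = u i, e2 ** v i = v i
             & v i ** e1 = v i],
         forall i,
           [/\ e2 ** u i = 0, u i ** e1 = 0, e1 ** v i = 0 & v i ** e2 = 0],
         forall i,
           [/\ u i ** u (i + 1) = v (i + 2), u (i + 1) ** u i = - v (i + 2),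
               v i ** v (i + 1) = u (i + 2) & v (i + 1) ** v i = - u (i + 2)]
       & (forall i, u i ** u i = 0 /\ v i ** v i = 0)
         /\ (forall i j, u i ** v j = (if i == j then - e1 else 0)
                      /\ v i ** u j = (if i == j then - e2 else 0))].

(* Main.v *)
(* A Hurwitz superalgebra graded by Gamma has a sector S = Gamma 0 :&: M 0 that
   is paired with itself by the polar form, because the polar form pairs
   degree g with degree - g and vanishes between the even and the odd part M 0
   and M 1.
   If S has a nonzero isotropic element, S contains an idempotent e, and the
   homogeneous elements of the Peirce space eC(1 - e), with their duals in
   (1 - e)Ce, form a canonical basis: the 3-grading or the Cartan grading
   refines Gamma.
   If S is anisotropic, every homogeneous element of M 0 or M 1 is
   nonisotropic, S contains K = F1 + Fw with w of nonzero trace, and homogeneous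
   elements v in M 0 orthogonal to K and u in M 1 rebuild C from K by
   Cayley-Dickson doubling: the main grading or its Z_2^2 refinement refines
   Gamma.
   As Gamma is fine it equals that refinement up to relabelling the degrees, and
   universality of both gradings turns the relabelling into a group
   isomorphism. *)
From HB Require Import structures.
Require Import Defs.
From mathcomp Require Import all_boot all_order all_algebra ring.
From Stdlib Require Import Classical.
Set Implicit Arguments.
Unset Strict Implicit.
Unset Printing Implicit Defensive.
Import GRing.Theory.
Local Open Scope ring_scope.

(** * Identities in Hurwitz algebras *)

(** The classification forgets $Q$ and $\alpha$: the double is itself a Hurwitz algebra [H] graded
    by parity, and only the dimensions of the two parts [M 0] and [M 1] are remembered.
    Characteristic 2 enters as $T(1)=2=0$. It makes 1 orthogonal to itself, so its partner in the
    self-paired sector is a [w] independent of 1. This is why the anisotropic doubling starts from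
    the plane $K$ in degree 0 and not from $F1$, and why it stops at $\mathbb{Z}_2$ or
    $\mathbb{Z}_2^2$. Fineness only says something about gradings already at hand. Hence each case
    has to build its grading in full: directness, closure under products, compatibility with parity,
    and the universal group. The product rules are extracted from multiplicativity of the norm by
    polarization, and equalities are then tested against the nondegenerate polar form. *)

Lemma span_ind (F : fieldType) (V : vectType F) (P : V -> Prop) (s : seq V) x :
  (forall k x y, P x -> P y -> P (k *: x + y)) -> P 0 ->
  (forall y, y \in s -> P y) -> x \in <<s>>%VS -> P x.
Proof.
move=> PZ P0; elim: s x => [|a s IH] x Ps.
  by rewrite span_nil memv0 => /eqP ->.
rewrite span_cons => /memv_addP [_ /vlineP [k ->] [y ys ->]].
apply: PZ; first by apply: Ps; rewrite inE eqxx.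
by apply: IH => // z zs; apply: Ps; rewrite inE zs orbT.
Qed.

Section HurwitzIdentities.
Variables (F : fieldType) (H : hurwitz F).
Local Notation N := (@hnorm F H).
Local Notation one := (hone H).

Definition hpolar : H -> H -> F := polar N.
Local Notation B := hpolar.
Definition htrace (x : H) : F := B x one.
Local Notation T := htrace.

Lemma hnormZ a x : N (a *: x) = a ^+ 2 * N x.
Proof. by case: (hnorm_quadratic H). Qed.

Lemma hpolarPl a x y z : B (a *: x + y) z = a * B x z + B y z.
Proof. by case: (hnorm_quadratic H) => _ [h _]; apply: (h z a x y). Qed.

Lemma hpolarPr a x y z : B z (a *: x + y) = a * B z x + B z y.
Proof. by case: (hnorm_quadratic H) => _ [_ h]; apply: (h z a x y). Qed.

HB.instance Definition _ z :=
  GRing.isLinear.Build F H F *%R (B z) (fun a x y => hpolarPr a x y z).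

Lemma hpolarC x y : B x y = B y x.
Proof. by rewrite /hpolar /polar [x + y]addrC addrAC. Qed.

Lemma hpolarDl x y z : B (x + y) z = B x z + B y z.
Proof. by rewrite !(hpolarC _ z) linearD. Qed.
Lemma hpolarDr x y z : B z (x + y) = B z x + B z y.
Proof. exact: linearD. Qed.
Lemma hpolarBl x y z : B (x - y) z = B x z - B y z.
Proof. by rewrite !(hpolarC _ z) linearB. Qed.
Lemma hpolarBr x y z : B z (x - y) = B z x - B z y.
Proof. exact: linearB. Qed.
Lemma hpolarNl x z : B (- x) z = - B x z.
Proof. by rewrite !(hpolarC _ z) linearN. Qed.
Lemma hpolarNr x z : B z (- x) = - B z x.
Proof. exact: linearN. Qed.
Lemma hpolarZl a x z : B (a *: x) z = a * B x z.
Proof. by rewrite !(hpolarC _ z) linearZ. Qed.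
Lemma hpolarZr a x z : B z (a *: x) = a * B z x.
Proof. exact: linearZ. Qed.
Lemma hpolar0l z : B 0 z = 0.
Proof. by rewrite hpolarC linear0. Qed.
Lemma hpolar0r z : B z 0 = 0.
Proof. exact: linear0. Qed.

Definition hpolarE := (hpolarDl, hpolarDr, hpolarBl, hpolarBr, hpolarNl,
  hpolarNr, hpolarZl, hpolarZr, hpolar0l, hpolar0r).

Lemma hnormD x y : N (x + y) = N x + N y + B x y.
Proof. by rewrite /hpolar /polar; ring. Qed.

Lemma hnorm0 : N 0 = 0.
Proof. by rewrite -(scale0r one) hnormZ expr0n mul0r. Qed.

Lemma hpolarxx x : B x x = N x *+ 2.
Proof. by rewrite /hpolar /polar -mulr2n -scaler_nat hnormZ; ring. Qed.

(** If N 1 = 0, multiplicativity makes N and its polar form vanish, so 1 would be a nonzero radical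
    vector of norm 0, against regularity. Otherwise N 1 cancels in N 1 * N 1 = N 1. *)
Lemma hnorm1 : N one = 1.
Proof.
have [N0|N0] := eqVneq (N one) 0; last first.
  by apply: (mulfI N0); rewrite -hnormM hmul1x mulr1.
have Nx x : N x = 0 by rewrite -[x]hmulx1 hnormM N0 mulr0.
have [/(_ one) h _] := hnorm_regular H.
suff /h : polar_radical N fullv one by rewrite N0 eqxx hone_neq0 => /(_ isT).
by split; [rewrite memvf | move=> y _; rewrite /polar !Nx !subr0].
Qed.

Lemma amulDl (x y z : H) : (x + y) ** z = x ** z + y ** z.
Proof. by rewrite -{1}[x]scale1r amulPl scale1r. Qed.
Lemma amulDr (x y z : H) : z ** (x + y) = z ** x + z ** y.
Proof. by rewrite -{1}[x]scale1r amulPr scale1r. Qed.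
Lemma amulZl a (x z : H) : (a *: x) ** z = a *: (x ** z).
Proof. by rewrite -[a *: x]addr0 amulPl amul0x addr0. Qed.
Lemma amulZr a (x z : H) : z ** (a *: x) = a *: (z ** x).
Proof. by rewrite -[a *: x]addr0 amulPr amulx0 addr0. Qed.
Lemma amulNl (x z : H) : (- x) ** z = - (x ** z).
Proof. by rewrite -scaleN1r amulZl scaleN1r. Qed.
Lemma amulNr (x z : H) : z ** (- x) = - (z ** x).
Proof. by rewrite -scaleN1r amulZr scaleN1r. Qed.
Lemma amulBl (x y z : H) : (x - y) ** z = x ** z - y ** z.
Proof. by rewrite amulDl amulNl. Qed.
Lemma amulBr (x y z : H) : z ** (x - y) = z ** x - z ** y.
Proof. by rewrite amulDr amulNr. Qed.

Definition amulE := (amulDl, amulDr, amulBl, amulBr, amulNl, amulNr,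
  amulZl, amulZr, @amul0x F H, @amulx0 F H, @hmul1x F H, @hmulx1 F H).

Lemma hpolarMl x y z : B (x ** y) (x ** z) = N x * B y z.
Proof. by rewrite /hpolar /polar -amulDr !hnormM; ring. Qed.

Lemma hpolarMr x y z : B (y ** x) (z ** x) = B y z * N x.
Proof. by rewrite /hpolar /polar -amulDl !hnormM; ring. Qed.

(** Linearization of [hpolarMl] in its left factor. Setting one argument to 1 gives the adjoint
    formulas [hpolar_adjl] and [hpolar_adjr]. *)
Lemma hpolarMM x y z w :
  B (x ** y) (z ** w) + B (x ** w) (z ** y) = B x z * B y w.
Proof.
have := hpolarMl (x + z) y w; rewrite !amulDl !hpolarE !hpolarMl hnormD.
rewrite (hpolarC (z ** y)) => h; apply: (addIr (N x * B y w + N z * B y w)).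
by transitivity ((N x + N z + B x z) * B y w); [rewrite -h|]; ring.
Qed.

Lemma hconjE x : hconj x = T x *: one - x. Proof. by []. Qed.

Lemma hconjD (x y : H) : hconj (x + y) = hconj x + hconj y. Proof. exact: linearD. Qed.

Lemma htrace1 : T one = 2%:R.
Proof. by rewrite /htrace hpolarxx hnorm1. Qed.

Lemma htrace_conj (x : H) : T (hconj x) = T x.
Proof.
rewrite /htrace hconjE !hpolarE -/(T one) htrace1 /htrace.
by ring.
Qed.

Lemma hconjK : involutive (@hconj F H).
Proof.
by move=> x; rewrite hconjE htrace_conj hconjE opprB addrC subrK.
Qed.

Lemma hpolar_adjl x y z : B (x ** y) z = B y ((hconj x) ** z).
Proof.
have := hpolarMM x y one z; rewrite !hmul1x -/(T x) => /(canRL (addrK _)) ->.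
by rewrite hconjE !amulE !hpolarE (hpolarC (x ** z)).
Qed.

Lemma hpolar_adjr x y z : B (x ** y) z = B x (z ** hconj y).
Proof.
have := hpolarMM x y z one; rewrite !hmulx1 => /(canRL (addrK _)) ->.
by rewrite hconjE !amulE !hpolarE /htrace mulrC.
Qed.

Lemma hpolar_conj x y : B (hconj x) (hconj y) = B x y.
Proof.
rewrite !hconjE !hpolarE !(hpolarC one) -!/(T _) htrace1.
by ring.
Qed.

Lemma hnorm_conj x : N (hconj x) = N x.
Proof.
rewrite hconjE hnormD -scaleN1r !hnormZ hnorm1 hpolarZl hpolarZr.
by rewrite hpolarC -/(T x); ring.
Qed.

Lemma htraceM x y : T (x ** y) = B x (hconj y).
Proof. by rewrite /htrace hpolar_adjr hmul1x. Qed.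

Lemma hpolarE_trace x y : B x y = T (x ** hconj y).
Proof. by rewrite htraceM hconjK. Qed.

Hypothesis dimH : (1 < \dim {:H})%N.

(* If r spans the radical then every x ** r lies in it, so right
   multiplication by r, which is injective, has rank at most one. *)
Lemma hpolar_nondeg x : (forall y, B x y = 0) -> x = 0.
Proof.
move=> xr; apply/eqP/negP => /negP x0; have [reg1 reg2] := hnorm_regular H.
have radx : polar_radical N fullv x by split=> [|y _]; [rewrite memvf|apply: xr].
have Nx := reg1 _ radx x0.
pose f := linfun (applyr (@amul F H) x).
have fE y : f y = y ** x by rewrite lfunE.
have kerf : lker f == 0%VS.
  apply/lker0P => y z; rewrite !fE => /eqP.
  rewrite -subr_eq0 -amulBl => /eqP yz0; apply/eqP; rewrite -subr_eq0.
  apply/negP => /negP yz.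
  have radyz : polar_radical N fullv (y - z).
    split=> [|t _]; first by rewrite memvf.
    by apply: (mulIf Nx); rewrite -hpolarMr yz0 hpolar0l mul0r.
  have := hnormM (y - z) x; rewrite yz0 hnorm0 => /esym/eqP.
  by rewrite mulf_eq0 (negPf Nx) (negPf (reg1 _ radyz yz)).
have : (f @: fullv <= <[x]>)%VS.
  apply/subvP => _ /memv_imgP [y _ ->]; rewrite fE.
  have radyx : polar_radical N fullv (y ** x).
    split=> [|t _]; first by rewrite memvf.
    by rewrite -/(B (y ** x) t) hpolar_adjl xr.
  by have [c ->] := reg2 _ _ radx radyx x0; rewrite memvZ ?memv_line.
move/dimvS; rewrite limg_dim_eq ?dim_vline; last first.
  by rewrite (eqP kerf) capv0.
by rewrite x0 leqNgt dimH.
Qed.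

(** The identities that follow are proved by pairing both sides with a test vector and moving
    factors across with the adjoint formulas. *)
Lemma hpolar_inj x y : (forall z, B x z = B y z) -> x = y.
Proof.
move=> h; apply/eqP; rewrite -subr_eq0; apply/eqP/hpolar_nondeg => z.
by rewrite hpolarBl h subrr.
Qed.

Lemma hconj_mulK (x y : H) : hconj x ** (x ** y) = N x *: y.
Proof.
by apply: hpolar_inj => z; rewrite hpolar_adjl hconjK hpolarMl hpolarZl.
Qed.

Lemma mul_hconjK (x y : H) : x ** (hconj x ** y) = N x *: y.
Proof. by rewrite -{1}[x]hconjK hconj_mulK hnorm_conj. Qed.

Lemma mulK_hconj (x y : H) : y ** x ** hconj x = N x *: y.
Proof.
apply: hpolar_inj => z; rewrite hpolar_adjr hconjK hpolarMr hpolarZl.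
exact: mulrC.
Qed.

Lemma mul_hconj (x : H) : x ** hconj x = N x *: one.
Proof. by rewrite -{1}[x]hmul1x mulK_hconj. Qed.

Lemma hconj_mul (x : H) : hconj x ** x = N x *: one.
Proof. by rewrite -{2}[x]hmulx1 hconj_mulK. Qed.

Lemma hsqrE (x : H) : x ** x = htrace x *: x - N x *: one.
Proof. by rewrite -mul_hconj hconjE !amulE opprB addrC subrK. Qed.

Lemma amulKl (x y : H) : x ** (x ** y) = htrace x *: (x ** y) - N x *: y.
Proof. by rewrite -mul_hconjK hconjE !amulE opprB addrC subrK. Qed.

Lemma amulKr (x y : H) : y ** x ** x = htrace x *: (y ** x) - N x *: y.
Proof. by rewrite -mulK_hconj hconjE !amulE opprB addrC subrK. Qed.

Lemma hconjM (x y : H) : hconj (x ** y) = hconj y ** hconj x.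
Proof.
apply: hpolar_inj => z.
rewrite -[z in LHS]hconjK hpolar_conj hpolar_adjr.
by rewrite [RHS]hpolar_adjr hconjK [RHS]hpolarC hpolar_adjl.
Qed.

(** A form of the middle Moufang identity: the right-hand side is the value of $x(yz)x$. *)
Lemma amul_mid (x y z : H) :
  x ** y ** (z ** x) = B x (hconj (y ** z)) *: x - N x *: hconj (y ** z).
Proof.
apply: hpolar_inj => t; rewrite !hconjM hpolar_adjr hconjM.
have := hpolarMM x y t (hconj x ** hconj z) => /(canRL (addrK _)) ->.
rewrite mul_hconjK [in RHS]hpolarBl ![in RHS]hpolarZl hpolarZl -[B y _]hpolar_adjl hpolar_adjr.
by rewrite (hpolarC (hconj z)) hpolar_adjr (hpolarC t) mulrC.
Qed.

Definition associator (x y z : H) : H := x ** y ** z - x ** (y ** z).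
Local Notation A := associator.

Lemma associatorPl k (a a' b c : H) : A (k *: a + a') b c = k *: A a b c + A a' b c.
Proof. by rewrite /associator !amulPl scalerBr opprD addrACA. Qed.
Lemma associatorPm k (a b b' c : H) : A a (k *: b + b') c = k *: A a b c + A a b' c.
Proof. by rewrite /associator !(amulPl, amulPr) scalerBr opprD addrACA. Qed.
Lemma associatorPr k (a b c c' : H) : A a b (k *: c + c') = k *: A a b c + A a b c'.
Proof. by rewrite /associator !amulPr scalerBr opprD addrACA. Qed.

Lemma associator1l (b c : H) : A one b c = 0.
Proof. by rewrite /associator !hmul1x subrr. Qed.
Lemma associator1m (a c : H) : A a one c = 0.
Proof. by rewrite /associator hmulx1 hmul1x subrr. Qed.
Lemma associator1r (a b : H) : A a b one = 0.
Proof. by rewrite /associator !hmulx1 subrr. Qed.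

Lemma associator_altl (a c : H) : A a a c = 0.
Proof.
by rewrite /associator amulKl hsqrE amulBl !amulZl hmul1x subrr.
Qed.
Lemma associator_altr (a c : H) : A a c c = 0.
Proof.
by rewrite /associator amulKr hsqrE amulBr !amulZr hmulx1 subrr.
Qed.

Lemma associatorCl (a b c : H) : A a b c = - A b a c.
Proof.
apply/eqP; rewrite -addr_eq0; apply/eqP.
have := associator_altl (1 *: a + b) c.
by rewrite associatorPl !associatorPm !associator_altl !scale1r add0r addr0.
Qed.
Lemma associator_altm (a b : H) : A a b a = 0.
Proof. by rewrite associatorCl associator_altr oppr0. Qed.

Lemma hpolar_associator1 (a b c : H) : B (A a b c) one = 0.
Proof.
rewrite hpolarBl hpolar_adjr hmul1x [B (a ** (b ** c)) _]hpolar_adjr hmul1x hconjM.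
by rewrite hpolar_adjr subrr.
Qed.
Lemma hpolar_associatorl (a b c : H) : B (A a b c) a = 0.
Proof.
rewrite hpolarBl hpolar_adjr hpolarMl.
have -> : B (a ** (b ** c)) a = N a * B (b ** c) one.
  by rewrite -hpolarMl hmulx1.
by rewrite hpolar_adjr hmul1x subrr.
Qed.
Lemma hpolar_associatorr (a b c : H) : B (A a b c) c = 0.
Proof.
rewrite hpolarBl; have -> : B (a ** b ** c) c = B (a ** b) one * N c.
  by rewrite -hpolarMr hmul1x.
rewrite [B (a ** (b ** c)) _]hpolar_adjr hconjM.
by rewrite mul_hconjK hpolarZr hpolar_adjr hmul1x mulrC subrr.
Qed.
Lemma hpolar_associatorm (a b c : H) : B (A a b c) b = 0.
Proof. by rewrite associatorCl hpolarNl hpolar_associatorl oppr0. Qed.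

(* [B (A a b c) x] is alternating and vanishes when one argument is 1. *)
Lemma hurwitz_assoc (x y z : H) : (\dim {:H} <= 4)%N -> x ** y ** z = x ** (y ** z).
Proof.
move=> dimH4; apply/eqP; rewrite -subr_eq0 -/(A x y z).
have [|x1] := boolP (x \in <<[:: one]>>%VS).
  move/(span_ind (P := fun x => A x y z = 0)) => -> //.
  - by move=> k a b ha hb; rewrite associatorPl ha hb scaler0 addr0.
  - by rewrite /associator !(amul0x, amulx0) subrr.
  - by move=> _ /[1!inE] /eqP ->; apply: associator1l.
have [|y1] := boolP (y \in <<[:: x; one]>>%VS).
  move/(span_ind (P := fun y => A x y z = 0)) => -> //.
  - by move=> k a b ha hb; rewrite associatorPm ha hb scaler0 addr0.
  - by rewrite /associator !(amul0x, amulx0) subrr.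
  - move=> _ /[!inE] /orP[] /eqP ->; first exact: associator_altl.
    exact: associator1m.
have [|z1] := boolP (z \in <<[:: y; x; one]>>%VS).
  move/(span_ind (P := fun z => A x y z = 0)) => -> //.
  - by move=> k a b ha hb; rewrite associatorPr ha hb scaler0 addr0.
  - by rewrite /associator !(amul0x, amulx0) subrr.
  - move=> _ /[!inE] /or3P[] /eqP ->; first exact: associator_altr.
      exact: associator_altm.
    exact: associator1r.
(* With no dependence left, 1, x, y, z form a basis because the dimension is at most 4, and the
   associator is orthogonal to each of them. *)
have fr : free [:: z; y; x; one].
  rewrite !free_cons z1 y1 x1 nil_free andbT span_nil memv0.
  exact: hone_neq0.
have full : <<[:: z; y; x; one]>>%VS = fullv.
  by apply/eqP; rewrite eqEdim subvf (eqP (fr : free _)).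
apply/eqP/hpolar_nondeg => t.
have : t \in <<[:: z; y; x; one]>>%VS by rewrite full memvf.
move/(span_ind (P := fun t => B (A x y z) t = 0)); apply.
- by move=> k a b ha hb; rewrite hpolarPr ha hb mulr0 addr0.
- exact: hpolar0r.
- move=> _ /[!inE] /or4P[] /eqP ->.
  + exact: hpolar_associatorr.
  + exact: hpolar_associatorm.
  + exact: hpolar_associatorl.
  + exact: hpolar_associator1.
Qed.

End HurwitzIdentities.

(** * The Cayley-Dickson double as a Hurwitz algebra *)

Section CayleyDicksonHurwitz.
Variables (F : fieldType) (Q : hurwitz F) (alpha : F).
Hypothesis alpha0 : alpha != 0.
Hypothesis dimQ1 : (1 < \dim {:Q})%N.
Hypothesis dimQ4 : (\dim {:Q} <= 4)%N.
Local Notation C := (CD Q alpha).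
Local Notation q := (@cd_norm F Q alpha).
Local Notation pairC a b := (((a : Q), (b : Q)) : C).

Lemma cd_mulE (a b c d : Q) :
  pairC a b ** pairC c d =
  pairC (a ** c - alpha *: (hconj d ** b)) (d ** a + b ** hconj c).
Proof. by []. Qed.

Lemma cd_polarE (a b c d : Q) :
  polar q (pairC a b) (pairC c d) = hpolar a c + alpha * hpolar b d.
Proof.
rewrite /polar /cd_norm /hpolar /polar.
change (hnorm (a + c) + alpha * hnorm (b + d) - (hnorm a + alpha * hnorm b)
  - (hnorm c + alpha * hnorm d) = hnorm (a + c) - hnorm a - hnorm c +
  alpha * (hnorm (b + d) - hnorm b - hnorm d)).
by ring.
Qed.

Lemma cd_one_neq0 : cd_one Q alpha != 0.
Proof.
apply/eqP => /(congr1 (fun x : Q * Q => x.1)) /= /eqP.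
by rewrite (negPf (hone_neq0 Q)).
Qed.

Lemma cd_mul1x (x : C) : cd_one Q alpha ** x = x.
Proof.
case: x => a b; rewrite [LHS]cd_mulE hmul1x hmulx1 amulx0 amul0x.
by rewrite scaler0 subr0 addr0.
Qed.

Lemma hconj1 (H : hurwitz F) : hconj (hone H) = hone H.
Proof. by rewrite hconjE htrace1 scaler_nat mulr2n addrK. Qed.

Lemma cd_mulx1 (x : C) : x ** cd_one Q alpha = x.
Proof.
case: x => a b; rewrite [LHS]cd_mulE hconj1 !hmulx1 linear0 !amul0x.
by rewrite scaler0 subr0 add0r.
Qed.

Lemma cd_norm_quadratic : quadratic_form q.
Proof.
split=> [k [a b]|].
  rewrite /cd_norm.
  change (hnorm (k *: a) + alpha * hnorm (k *: b) =
    k ^+ 2 * (hnorm a + alpha * hnorm b)).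
  by rewrite !hnormZ; ring.
split=> -[a b] k [c d] [e f].
  change (polar q (pairC (k *: c + e) (k *: d + f)) (pairC a b) =
   k * polar q (pairC c d) (pairC a b) + polar q (pairC e f) (pairC a b)).
  by rewrite !cd_polarE !hpolarPl; ring.
change (polar q (pairC a b) (pairC (k *: c + e) (k *: d + f)) =
   k * polar q (pairC a b) (pairC c d) + polar q (pairC a b) (pairC e f)).
by rewrite !cd_polarE !hpolarPr; ring.
Qed.

Lemma cd_norm_regular : regular_on q fullv.
Proof.
have rad0 x : polar_radical q fullv x -> x = 0.
  case: x => a b [_ h]; congr pair.
    apply: (hpolar_nondeg dimQ1) => c.
    have := h (pairC c 0) (memvf _).
    by rewrite cd_polarE hpolar0r mulr0 addr0.
  apply: (hpolar_nondeg dimQ1) => c; apply: (mulfI alpha0); rewrite mulr0.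
  have := h (pairC 0 c) (memvf _).
  by rewrite cd_polarE hpolar0r add0r.
split=> [x /rad0 ->|x y /rad0 ->]; by rewrite eqxx.
Qed.

Lemma cd_normM (x y : C) : q (x ** y) = q x * q y.
Proof.
case: x y => [a b] [c d]; rewrite [_ ** _]cd_mulE /cd_norm.
change (hnorm (a ** c - alpha *: (hconj d ** b)) +
  alpha * hnorm (d ** a + b ** hconj c) =
  (hnorm a + alpha * hnorm b) * (hnorm c + alpha * hnorm d)).
rewrite !hnormD -scaleNr.
rewrite hnormZ hpolarZr !hnormM !hnorm_conj.
(* The two mixed terms of the norm cancel. This needs Q associative, hence the bound 4 on its
   dimension. *)
have -> : hpolar (a ** c) (hconj d ** b) = hpolar (d ** a) (b ** hconj c).
  by rewrite -hpolar_adjl -hurwitz_assoc // hpolar_adjr.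
by ring.
Qed.

Definition cd_hurwitz : hurwitz F :=
  Hurwitz cd_one_neq0 cd_mul1x cd_mulx1 cd_norm_quadratic cd_norm_regular
    cd_normM.

End CayleyDicksonHurwitz.

(** * Gradings and refinements *)

Section GradingTheory.
Variables (F : fieldType) (A : algebra F) (G : zmodType).
Variable Gamma : G -> {vspace A}.
Hypothesis grG : is_grading Gamma.

Lemma sum_at (s : seq G) h (z : A) : uniq s -> h \in s ->
  \sum_(g <- s) (if g == h then z else 0) = z.
Proof.
move=> us hs; rewrite (bigD1_seq h) //= eqxx big1 ?addr0 // => g.
by move=> /negPf ->.
Qed.

Lemma sumv_seq_decomp (s : seq G) (x : A) : uniq s ->
  x \in (\sum_(g <- s) Gamma g)%VS ->
  exists y : G -> A, [/\ forall g, y g \in Gamma g,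
    forall g, g \notin s -> y g = 0 & x = \sum_(g <- s) y g].
Proof.
elim: s x => [|a s IH] x.
  rewrite big_nil memv0 => _ /eqP ->; exists (fun=> 0); rewrite big_nil.
  by split=> // g; rewrite mem0v.
rewrite /= big_cons => /andP[as' us] /memv_addP [v va [w /(IH _ us)]].
case=> y [yin y0 ->] ->; exists (fun g => if g == a then v else y g).
split=> [g|g|]; first by case: eqP => [->|].
  by rewrite inE negb_or => /andP[/negPf -> /y0].
rewrite big_cons eqxx; congr (_ + _); apply: eq_big_seq => g gs.
by case: eqP gs as' => [->|//] ->.
Qed.

Lemma grading_decomp x : exists (s : seq G) (y : G -> A),
  [/\ uniq s, forall g, y g \in Gamma g,
    forall g, g \notin s -> y g = 0 & x = \sum_(g <- s) y g].
Proof.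
have [/(_ x) [s xs] _ _] := grG.
have : x \in (\sum_(g <- undup s) Gamma g)%VS.
  apply: subvP xs; set U := (X in (_ <= X)%VS).
  rewrite big_seq; elim/big_ind : _ => [|V W|g gs].
  - exact: sub0v.
  - by rewrite subv_add => -> ->.
  - by rewrite /U (bigD1_seq g) ?undup_uniq ?mem_undup ?addvSl.
case/(sumv_seq_decomp (undup_uniq s)) => y [h1 h2 h3].
by exists (undup s), y; split=> //; apply: undup_uniq.
Qed.

Lemma grading_ind (P : A -> Prop) :
  P 0 -> (forall x y, P x -> P y -> P (x + y)) ->
  (forall g x, x \in Gamma g -> P x) -> forall x, P x.
Proof.
move=> P0 PD Ph x; have [s [y [_ yin _ ->]]] := grading_decomp x.
by elim/big_ind: _ => // g _; apply: Ph (yin g).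
Qed.

Lemma grading_component (s : seq G) (y : G -> A) h z : uniq s ->
  (forall g, y g \in Gamma g) -> (forall g, g \notin s -> y g = 0) ->
  z \in Gamma h -> \sum_(g <- s) y g = z -> y h = z.
Proof.
move=> us yin y0 zh yz; have [_ indep _] := grG.
(* Correcting y by z at h gives a family of sum 0 over s enlarged by h, whether or not h already
   lies in s. *)
pose y' g := y g - (if g == h then z else 0).
have y'in g : y' g \in Gamma g.
  by rewrite rpredB //; case: eqP => [->|_] //; rewrite mem0v.
have uu := undup_uniq (h :: s).
suff /(indep _ _ uu y'in) : \sum_(g <- undup (h :: s)) y' g = 0.
  move=> /(_ h); rewrite mem_undup inE eqxx /y' eqxx => /(_ isT) /eqP.
  by rewrite subr_eq0 => /eqP.
have -> : \sum_(g <- undup (h :: s)) y' g = \sum_(g <- undup (h :: s)) y g - z.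
  by rewrite sumrB sum_at ?mem_undup ?inE ?eqxx.
rewrite /= undup_id //; case: ifP => hs; first by rewrite yz subrr.
by rewrite big_cons y0 ?hs // add0r yz subrr.
Qed.

Lemma grading_eq0 g x : x \in Gamma g ->
  (exists a b, [/\ a != g, b != g & exists2 y, y \in Gamma a &
    exists2 z, z \in Gamma b & x = y + z]) -> x = 0.
Proof.
move=> xg [a [b [ag bg [y ya [z zb xyz]]]]].
(* The degrees a and b may coincide, so their contributions are added. *)
pose w h := (if h == a then y else 0) + (if h == b then z else 0).
have wg : w g = 0.
  by rewrite /w ![g == _]eq_sym (negPf ag) (negPf bg) addr0.
rewrite -wg; apply: esym; apply: (@grading_component (undup [:: a; b])) => //.
- exact: undup_uniq.
- move=> h; rewrite rpredD //; case: eqP => [->|] //; by rewrite mem0v.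
- move=> h; rewrite mem_undup !inE negb_or /w => /andP[/negPf -> /negPf ->].
  by rewrite addr0.
rewrite xyz big_split; congr (_ + _).
  by apply: sum_at; rewrite ?undup_uniq // mem_undup !inE eqxx.
by apply: sum_at; rewrite ?undup_uniq // mem_undup !inE eqxx orbT.
Qed.

Lemma grading_inj g h x : x \in Gamma g -> x \in Gamma h -> x != 0 -> g = h.
Proof.
move=> xg xh x0; apply/eqP/negP => /negP gh; case/eqP: x0.
apply: (grading_eq0 xg); exists h, h; rewrite eq_sym gh; split=> //.
by exists x => //; exists 0; rewrite ?addr0 ?mem0v.
Qed.

End GradingTheory.

(** * Unit, trace and polar form of a graded Hurwitz algebra *)

Section GradedHurwitz.
Variables (F : fieldType) (H : hurwitz F) (G : zmodType).
Variable Gamma : G -> {vspace H}.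
Hypothesis grG : is_grading Gamma.
Hypothesis dimH : (1 < \dim {:H})%N.
Local Notation one := (hone H).

(** Comparing components of degree h in x = x ** 1, for x of degree h, shows that the degree 0
    component of 1 is a right identity; applied to 1 itself it is 1. *)
Lemma graded_one : one \in Gamma 0.
Proof.
have [s [y [us yin y0 e]]] := grading_decomp grG one.
have [_ _ grM] := grG.
suff y1 : forall x, x ** y 0 = x by rewrite -[one](y1 one) hmul1x.
apply: (grading_ind grG) => [|a b ha hb|h x xh]; first exact: amul0x.
  by rewrite amulDl ha hb.
have := @grading_component _ _ _ _ grG [seq h + g | g <- s]
  (fun k => x ** y (k - h)) h x; rewrite subrr; apply.
- by rewrite map_inj_uniq //; apply: addrI.
- by move=> g; rewrite -{2}[g](subrKC h); apply: grM.
- move=> g gs; rewrite y0 ?amulx0 //; apply: contra gs => gs.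
  by apply/mapP; exists (g - h); rewrite ?subrKC.
- exact: xh.
rewrite big_map -{2}[x]hmulx1 e [RHS]linear_sum /=.
by apply: eq_bigr => g _; rewrite [h + g]addrC addrK.
Qed.

(** In T(x) x = x ** x + N(x) 1 the left side has degree g, while the summands on the right have
    degrees 2g and 0, both different from g. *)
Lemma graded_trace g x : x \in Gamma g -> g != 0 -> htrace x = 0.
Proof.
move=> xg g0; apply/eqP/negP => /negP t0; have [_ _ grM] := grG.
have : htrace x *: x = 0.
  apply: (grading_eq0 grG (memvZ _ xg)); exists (g + g), 0.
  split; [by rewrite -subr_eq0 addrK|by rewrite eq_sym|].
  exists (x ** x); first exact: grM.
  exists (hnorm x *: one); first by rewrite memvZ ?graded_one.
  by rewrite (hsqrE dimH) subrK.
move/eqP; rewrite scaler_eq0 (negPf t0) /= => /eqP x0.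
by move: t0; rewrite x0 /htrace hpolar0l eqxx.
Qed.

Lemma graded_conj g x : x \in Gamma g -> hconj x \in Gamma g.
Proof.
move=> xg; have [g0|g0] := eqVneq g 0.
  by rewrite hconjE rpredB // memvZ // g0 graded_one.
by rewrite hconjE (graded_trace xg g0) scale0r sub0r rpredN.
Qed.

Lemma graded_polar g h x y : x \in Gamma g -> y \in Gamma h -> g + h != 0 ->
  hpolar x y = 0.
Proof.
move=> xg yh gh; rewrite hpolarE_trace; have [_ _ grM] := grG.
by apply: graded_trace gh; apply: grM xg _; apply: graded_conj.
Qed.

End GradedHurwitz.

Lemma ord2_cases (i : 'Z_2) : i = 0 \/ i = 1.
Proof.
by case: i => [[|[|//]] ?]; [left|right]; apply: val_inj.
Qed.

(** * Refinements and universal grading groups *)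

Section Refinements.
Variables (F : fieldType) (A : algebra F) (G H : zmodType).
Variables (Gamma : G -> {vspace A}) (Delta : H -> {vspace A}).

Lemma in_supportP (K : zmodType) (D : K -> {vspace A}) g :
  reflect (exists2 x, x \in D g & x != 0) (in_support D g).
Proof.
apply: (iffP idP) => [D0|[x xD]].
  by exists (vpick (D g)); rewrite ?memv_pick ?vpick0.
by apply: contraNneq => D0; rewrite -memv0 -D0.
Qed.

Lemma universal_additive_eq (K : zmodType) (f1 f2 : {additive G -> K}) :
  universal_grading_group Gamma ->
  (forall g, in_support Gamma g -> f1 g = f2 g) -> f1 =1 f2.
Proof.
move=> [gen _] f12 g; have [s [c [/allP ss ->]]] := gen g.
rewrite !raddf_sum; apply: eq_big_seq => h /ss /f12.
by rewrite !raddfMz => ->.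
Qed.

(** Choosing for each degree of [Delta] a component of [Gamma] that contains it respects the
    defining relations: a nonzero product lies in the components of degrees [f a + f b] and [f c],
    which must then agree. *)
Lemma refines_additive :
  is_grading Gamma -> is_grading Delta -> universal_grading_group Delta ->
  refines Delta Gamma -> exists phi : {additive H -> G},
  forall h, in_support Delta h -> (Delta h <= Gamma (phi h))%VS.
Proof.
move=> grG grD [_ uD] DG; pose f h := xchoose (DG h).
have fP h : (Delta h <= Gamma (f h))%VS := xchooseP (DG h).
have [|phi phiE] := uD _ f.
  move=> a b c [[x [y [xa yb xy0]]] rel].
  have [_ _ grM] := grG.
  apply: (grading_inj grG _ _ xy0).
    by apply: grM; apply: subvP (fP _) _ _.
  by apply: subvP (fP _) _ _; apply: rel.
by exists phi => h /phiE ->; apply: fP.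
Qed.

End Refinements.

Lemma refines_support (F : fieldType) (A : algebra F) (G H : zmodType)
    (Gamma : G -> {vspace A}) (Delta : H -> {vspace A}) g h :
  in_support Gamma g -> (Gamma g <= Delta h)%VS -> in_support Delta h.
Proof.
move=> /in_supportP [x xg x0] /subvP sub; apply/in_supportP.
by exists x => //; apply: sub.
Qed.

Lemma refines_antisym (F : fieldType) (A : algebra F) (G H : zmodType)
    (Gamma : G -> {vspace A}) (Delta : H -> {vspace A}) g h g' :
  is_grading Gamma -> in_support Gamma g ->
  (Gamma g <= Delta h)%VS -> (Delta h <= Gamma g')%VS -> g = g'.
Proof.
move=> grG /in_supportP [x xg x0] /subvP sub1 /subvP sub2.
by apply: (grading_inj grG xg _ x0); apply/sub2/sub1.
Qed.

(** The two homomorphisms between the groups are mutually inverse on the supports, and the supports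
    generate. *)
Lemma mutual_refinements_isomorphic (F : fieldType) (A : algebra F)
    (G H : zmodType) (Gamma : G -> {vspace A}) (Delta : H -> {vspace A}) :
  is_grading Gamma -> is_grading Delta ->
  universal_grading_group Gamma -> universal_grading_group Delta ->
  refines Gamma Delta -> refines Delta Gamma -> isomorphic_groups G H.
Proof.
move=> grG grD uG uD GD DG.
have [phi phiP] := refines_additive grD grG uG GD.
have [psi psiP] := refines_additive grG grD uD DG.
exists phi; exists psi.
- apply: (universal_additive_eq (f1 := psi \o phi) (f2 := idfun) uG) => g sg /=.
  apply: esym; apply: (refines_antisym grG sg (phiP _ sg)).
  exact/psiP/(refines_support sg (phiP _ sg)).
- apply: (universal_additive_eq (f1 := phi \o psi) (f2 := idfun) uD) => h sh /=.
  apply: esym; apply: (refines_antisym grD sh (psiP _ sh)).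
  exact/phiP/(refines_support sh (psiP _ sh)).
Qed.

Section SuperGradings.
Variables (F : fieldType) (C : superalgebra F) (G : zmodType).
Variable Gamma : G -> {vspace C}.
Hypothesis sgr : is_super_grading Gamma.

Lemma super_grading_ind i (P : C -> Prop) :
  P 0 -> (forall x y, P x -> P y -> P (x + y)) ->
  (forall g x, x \in Gamma g -> x \in main C i -> P x) ->
  forall x, x \in main C i -> P x.
Proof.
move=> P0 PD Ph x xi; have [gr sup] := sgr; have mgr := main_grading C.
(* Induction on homogeneous elements may leave [main C i], so the property carried along is that the
   parity i part of an arbitrary element satisfies P. *)
have [z [y [Pz zi yj xzy]]] : exists z y, [/\ P z, z \in main C i,
    y \in main C (1 - i) & x = z + y].
  move: (x); apply: (grading_ind gr) => [|u v|g u].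
  - by exists 0, 0; rewrite !mem0v addr0.
  - move=> [a [b [pa ai bi ->]]] [c [d [pc ci di ->]]].
    exists (a + c), (b + d); rewrite addrACA !rpredD //; split=> //.
    exact: PD.
  - rewrite sup => /memv_addP[a /memv_capP[ag a0] [b /memv_capP[bg b1] ->]].
    have [i0|i1] := ord2_cases i; subst i.
      by exists a, b; rewrite subr0; split=> //; apply: Ph ag _.
    exists b, a; rewrite subrr; split=> //; first by apply: Ph bg _.
    exact: addrC.
suff y0 : y = 0 by rewrite xzy y0 addr0.
apply: (grading_eq0 mgr yj).
have ij : i != 1 - i by case: (i) => [[|[|//]] ?].
exists i, i; split=> //; exists x => //; exists (- z); first by rewrite rpredN.
by rewrite xzy addrC addKr.
Qed.

(** This is the source of homogeneous witnesses later on: an additive property that fails on a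
    parity part fails at an element homogeneous for both gradings. *)
Lemma super_grading_ex i (P : C -> Prop) x :
  P 0 -> (forall x y, P x -> P y -> P (x + y)) ->
  x \in main C i -> ~ P x ->
  exists g y, [/\ y \in Gamma g, y \in main C i & ~ P y].
Proof.
move=> P0 PD xi nPx; apply: NNPP => h; apply: nPx.
apply: super_grading_ind xi => // g y yg yi; apply: NNPP => nPy.
by apply: h; exists g, y.
Qed.

(** Reduces each case to a super grading [Delta] of known universal group that refines [Gamma]:
    fineness forces the converse refinement, so the nonzero components coincide and the identity map
    is an equivalence. *)
Lemma fine_up_to_equivalence (H : zmodType) (Delta : H -> {vspace C}) P :
  is_fine_grading Gamma -> universal_grading_group Gamma ->
  is_super_grading Delta -> universal_grading_group Delta ->
  refines Delta Gamma -> P Delta -> up_to_equivalence Gamma P.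
Proof.
move=> [_ fineG] uG sD uD DG PD.
have GD : refines Gamma Delta.
  by apply: NNPP => h; apply: (fineG _ _ sD); split.
have [[grG _] [grD _]] := (sgr, sD).
split; first exact: (mutual_refinements_isomorphic grG grD).
exists Delta; split=> //; exists \1%VF; split; last first.
  move=> g sg; have [h gh] := GD g; have [g' hg'] := DG h.
  exists h; rewrite lim1g; apply/eqP; rewrite eqEsubv gh.
  by rewrite (refines_antisym grG sg gh hg').
split=> [|x y|i]; last by rewrite lim1g.
  by exists \1%VF => x; rewrite !id_lfunE.
by rewrite !id_lfunE.
Qed.

End SuperGradings.

(** * Gradings built from finitely many components *)

Section ComponentGradings.
Variables (F : fieldType) (A : algebra F) (G : zmodType) (I : finType).
Variables (W : I -> {vspace A}) (deg : I -> G).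

(** A grading is a function on the whole group, here extended by 0 from a finite list of components.
    For injective [deg] the sum has at most one term. *)
Definition components_by_degree (g : G) : {vspace A} :=
  (\sum_(i | deg i == g) W i)%VS.
Local Notation D := components_by_degree.

Hypothesis deg_inj : injective deg.

Lemma components_deg i : D (deg i) = W i.
Proof.
rewrite /D (eq_bigl (pred1 i)) ?big_pred1_eq // => j /=.
by rewrite (inj_eq deg_inj).
Qed.

Lemma components_out g : (forall i, deg i != g) -> D g = 0%VS.
Proof. by move=> h; rewrite /D big1 // => i; rewrite (negPf (h i)). Qed.

Lemma components_cases g : (exists i, g = deg i) \/ D g = 0%VS.
Proof.
have [/existsP [i /eqP <-]|] := boolP [exists i, deg i == g].
  by left; exists i.
by rewrite negb_exists => /forallP /components_out; right.
Qed.

Lemma components_refines (K : zmodType) (Gamma : K -> {vspace A}) :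
  (forall i, exists k, (W i <= Gamma k)%VS) -> refines D Gamma.
Proof.
move=> WG g; have [[i ->]|->] := components_cases g.
  by rewrite components_deg; apply: WG.
by exists 0; apply: sub0v.
Qed.

Hypothesis W_full : (fullv <= \sum_i W i)%VS.
Hypothesis W_dim : (\sum_i \dim (W i) <= \dim {:A})%N.
Hypothesis W_mul : forall i j x y, x \in W i -> y \in W j ->
  x ** y \in D (deg i + deg j).

Lemma components_grading : is_grading D.
Proof.
(* The W i span A and their dimensions add up to at most that of A, which forces directness. *)
have Wdirect : directv (\sum_i W i).
  rewrite directvE /= eqn_leq dimv_leq_sum.
  by apply: leq_trans W_dim (dimvS W_full).
split=> [x|s x us xin s0 g gs|g h x y].
- exists [seq deg i | i <- enum I].
  rewrite big_map big_enum /=; apply: subvP (memvf x).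
  apply: subv_trans W_full _; apply/subv_sumP => i _.
  by rewrite (sumv_sup i) // components_deg.
- pose us' i := if deg i \in s then x (deg i) else 0.
  have us'in i : us' i \in W i.
    by rewrite /us'; case: ifP; rewrite ?mem0v // -components_deg xin.
  have [[i gi]|D0] := components_cases g; last first.
    by apply/eqP; rewrite -memv0 -D0.
  suff us'0 : \sum_i us' i = 0.
    have /directv_sum_independent/(_ us' (fun i _ => us'in i) us'0 i isT) :=
      Wdirect.
    by rewrite /us' -gi gs.
  (* The sum over the sequence s becomes a sum over I: a degree outside the image of [deg] carries a
     zero component, and an index whose degree is not in s contributes 0 by definition of [us']. *)
  transitivity (\sum_(h <- s) x h); last exact: s0.
  rewrite [RHS](bigID (mem [seq deg i | i <- enum I])) /=.
  rewrite [X in _ = _ + X]big1 => [|h hI]; last first.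
    apply/eqP; rewrite -memv0 -(@components_out h) // => j.
    by apply: contra hI => /eqP <-; rewrite map_f ?mem_enum.
  rewrite addr0 -[RHS]big_filter.
  rewrite [RHS](perm_big [seq deg i | i <- enum I & deg i \in s]) /=; last first.
    apply: uniq_perm; rewrite ?filter_uniq ?map_inj_uniq ?filter_uniq -?enumT ?enum_uniq //.
    move=> h; rewrite mem_filter; apply/andP/mapP.
      case=> /mapP [j _ ->] js; exists j => //.
      by rewrite mem_filter js mem_enum.
    case=> j; rewrite mem_filter => /andP[js _] ->.
    by rewrite map_f ?mem_enum.
  by rewrite big_map big_filter big_enum_cond /us' -big_mkcond.
- have [[i ->]|->] := components_cases g; last first.
    by rewrite memv0 => /eqP -> _; rewrite amul0x mem0v.
  have [[j ->]|->] := components_cases h; last first.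
    by move=> _; rewrite memv0 => /eqP ->; rewrite amulx0 mem0v.
  by rewrite !components_deg; apply: W_mul.
Qed.

End ComponentGradings.

Lemma components_super (F : fieldType) (C : superalgebra F) (G : zmodType)
    (I : finType) (W : I -> {vspace C}) (deg : I -> G) (sg : I -> 'Z_2) :
  injective deg -> is_grading (components_by_degree W deg) ->
  (forall i, W i <= main C (sg i))%VS ->
  is_super_grading (components_by_degree W deg).
Proof.
move=> deg_inj gr sub; split=> // g; apply/eqP; rewrite eqEsubv.
rewrite subv_add !capvSl /= andbT.
have [[i ->]|->] := components_cases W deg g; last exact: sub0v.
rewrite components_deg //.
have := sub i; have [->|->] := ord2_cases (sg i) => /capv_idPl {1}<-.
  exact: addvSl.
exact: addvSr.
Qed.

Lemma components_sector (F : fieldType) (C : superalgebra F) (G : zmodType)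
    (I : finType) (W : I -> {vspace C}) (deg : I -> G) (sg : I -> 'Z_2) i :
  injective deg -> (forall i, W i <= main C (sg i))%VS ->
  (components_by_degree W deg (deg i) :&: main C (sg i))%VS = W i.
Proof. by move=> deg_inj sub; rewrite components_deg //; apply/capv_idPl. Qed.

Lemma additive_of (G H : zmodType) (f : G -> H) :
  (forall x y, f (x + y) = f x + f y) ->
  exists phi : {additive G -> H}, phi =1 f.
Proof.
move=> fD.
have f0 : f 0 = 0 by apply: (addrI (f 0)); rewrite -fD !addr0.
have fB : zmod_morphism f.
  move=> x y; apply: (addIr (f y)); rewrite -fD !subrK //.
pose m := GRing.isZmodMorphism.Build G H f fB.
pose phi : {additive G -> H} := HB.pack f m.
by exists phi.
Qed.

(** Products of nonisotropic elements are nonisotropic, so any two components have a nonzero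
    product. The relations then say that f is additive on all of G. *)
Lemma nonisotropic_universal (F : fieldType) (H : hurwitz F) (G : zmodType)
    (Gamma : G -> {vspace H}) : is_grading Gamma ->
  (forall g, exists2 x, x \in Gamma g & hnorm x != 0) ->
  universal_grading_group Gamma.
Proof.
move=> [_ _ grM] niso.
have neq0 (x : H) : hnorm x != 0 -> x != 0.
  by apply: contraNneq => ->; rewrite hnorm0.
split=> [g|K f fM].
  exists [:: g], (fun=> 1); rewrite big_seq1 mulr1z; split=> //=.
  rewrite andbT; apply/in_supportP; have [x xg /neq0 x0] := niso g.
  by exists x.
have [|phi phiE] := @additive_of G K f; last by exists phi => g _; apply: phiE.
move=> g h; apply: esym; apply: fM; split; last exact: grM.
have [x xg x0] := niso g; have [y yh y0] := niso h.
exists x, y; split=> //; apply: neq0.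
by rewrite hnormM mulf_neq0.
Qed.

(** * Peirce decomposition *)

Section Peirce.
Variables (F : fieldType) (H : hurwitz F).
Hypothesis dimH : (1 < \dim {:H})%N.
Local Notation N := (@hnorm F H).
Local Notation B := (@hpolar F H).
Local Notation T := (@htrace F H).
Local Notation one := (hone H).

Lemma hconj_mul_polarized (x y z : H) :
  hconj x ** (z ** y) + hconj z ** (x ** y) = B x z *: y.
Proof.
have := hconj_mulK dimH (x + z) y.
rewrite hconjD (amulDl (hconj x)) !(amulDl x) !(amulDr (x ** y)).
rewrite !hconj_mulK // hnormD !scalerDl => h.
apply: (addIr (N x *: y + N z *: y)); rewrite [RHS]addrC -h.
by rewrite [LHS](AC (2*2) ((3*1)*(2*4))).
Qed.

Lemma mul_hconj_polarized (x y z : H) :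
  y ** x ** hconj z + y ** z ** hconj x = B x z *: y.
Proof.
have := mulK_hconj dimH (x + z) y.
rewrite hconjD (amulDr (hconj x)) !(amulDr x z) !(amulDl (y ** x)).
rewrite !mulK_hconj // hnormD !scalerDl => h.
apply: (addIr (N x *: y + N z *: y)); rewrite [RHS]addrC -h.
by rewrite [LHS](AC (2*2) ((3*2)*(1*4))).
Qed.

(** By [hsqrE] these are the idempotents other than 0 and 1. *)
Definition hurwitz_idempotent (e : H) := N e = 0 /\ T e = 1.

(* The Peirce space U = eH(1 - e); V is the same space for the idempotent
   [hconj e = 1 - e]. *)
Definition peirce (e x : H) := e ** x = x /\ x ** hconj e = x.

Lemma hconj_idempotent e : hurwitz_idempotent e -> hurwitz_idempotent (hconj e).
Proof. by rewrite /hurwitz_idempotent hnorm_conj htrace_conj. Qed.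

Section Idempotent.
Variable e : H.
Hypothesis eI : hurwitz_idempotent e.
Local Notation e' := (hconj e).
Local Notation U := (peirce e).
Local Notation V := (peirce (hconj e)).

Lemma idempotent_sqr : e ** e = e.
Proof. by rewrite hsqrE // eI.1 eI.2 scale1r scale0r subr0. Qed.
Lemma idempotent_mul_conj : e ** e' = 0.
Proof. by rewrite mul_hconj // eI.1 scale0r. Qed.
Lemma idempotent_conj_mul : e' ** e = 0.
Proof. by rewrite hconj_mul // eI.1 scale0r. Qed.
Lemma idempotent_sum : e + e' = one.
Proof. by rewrite hconjE eI.2 scale1r addrC subrK. Qed.
Lemma idempotent_polar : B e e' = 1.
Proof. by rewrite -htraceM idempotent_sqr eI.2. Qed.
Lemma idempotent_polar_self : B e e = 0.
Proof. by rewrite hpolarxx eI.1 mul0rn. Qed.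

Lemma peirceP x : U x -> [/\ e ** x = x, x ** e' = x, e' ** x = 0 & x ** e = 0].
Proof.
move=> [ex xe]; split=> //.
  by have := hconj_mulK dimH e x; rewrite ex eI.1 scale0r.
have := mulK_hconj dimH e' x; rewrite xe hconjK hnorm_conj eI.1.
by rewrite scale0r.
Qed.

Lemma peirce_polar_e x : U x -> B x e = 0.
Proof.
by case=> ex _; rewrite -ex -{2}[e]hmulx1 hpolarMl eI.1 mul0r.
Qed.
Lemma peirce_polar_conj x : U x -> B x e' = 0.
Proof.
case=> _ xe; rewrite -xe -[X in B _ X]hmul1x hpolarMr hnorm_conj eI.1.
exact: mulr0.
Qed.
Lemma peirce_trace x : U x -> T x = 0.
Proof.
move=> Ux; rewrite /htrace -idempotent_sum hpolarDr peirce_polar_e //.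
by rewrite peirce_polar_conj // addr0.
Qed.
Lemma peirce_hconj x : U x -> hconj x = - x.
Proof. by move=> Ux; rewrite hconjE peirce_trace // scale0r sub0r. Qed.
Lemma peirce_polar x y : U x -> U y -> B x y = 0.
Proof. by move=> [<- _] [<- _]; rewrite hpolarMl eI.1 mul0r. Qed.
Lemma peirce_norm x : U x -> N x = 0.
Proof. by move=> [<- _]; rewrite hnormM eI.1 mul0r. Qed.
Lemma peirce_sqr x : U x -> x ** x = 0.
Proof.
by move=> Ux; rewrite hsqrE // peirce_trace // peirce_norm // !scale0r subr0.
Qed.
Lemma peirceZ a x : U x -> U (a *: x).
Proof. by case=> ex xe; split; rewrite ?amulZr ?amulZl ?ex ?xe. Qed.
Lemma peirceD x y : U x -> U y -> U (x + y).
Proof.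
by move=> [ex xe] [ey ye]; split; [rewrite amulDr ex ey | rewrite amulDl xe ye].
Qed.
Lemma peirce_anticomm x y : U x -> U y -> x ** y = - (y ** x).
Proof.
move=> Ux Uy; apply/eqP; rewrite -addr_eq0; apply/eqP.
have := peirce_sqr (peirceD Ux Uy).
by rewrite !amulDl !amulDr !peirce_sqr // add0r addr0.
Qed.

(** Together with [peirce_sqr] this makes B (x ** y) z an alternating trilinear form on U. A
    canonical Cayley basis is a triple in U on which it takes the value 1. *)
Lemma peirce_polar_cyclic x y z : U x -> U y -> U z ->
  B (x ** y) z = B (y ** z) x.
Proof.
move=> Ux Uy Uz; rewrite hpolar_adjr peirce_hconj // amulNr.
by rewrite -peirce_anticomm // hpolarC.
Qed.

(** Since x is orthogonal to e, polarization gives $\bar e(xy)=-\bar x(ey)=xy$; the other side is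
    symmetric. *)
Lemma peirceM x y : U x -> U y -> V (x ** y).
Proof.
move=> Ux Uy; rewrite /peirce hconjK.
have [ex xe' e'x xe] := peirceP Ux; have [ey ye' e'y ye] := peirceP Uy.
split.
  have := hconj_mul_polarized x y e; rewrite ey peirce_polar_e // scale0r.
  rewrite peirce_hconj // amulNl => /eqP; rewrite addrC subr_eq0 => /eqP.
  by [].
have := mul_hconj_polarized y x e'; rewrite hconjK peirce_polar_conj // scale0r.
by rewrite xe' peirce_hconj // amulNr => /eqP; rewrite subr_eq0 => /eqP.
Qed.

End Idempotent.

(** Left multiplication by e fixes [x ** y] and kills [y ** x], so it reduces $-xy-yx=B(x,y)1$ to
    the claim. *)
Lemma peirceMV e x y : hurwitz_idempotent e ->
  peirce e x -> peirce (hconj e) y -> x ** y = - B x y *: e.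
Proof.
move=> eI Ux Vy; have e'I := hconj_idempotent eI.
have [ex xe' e'x xe] := peirceP eI Ux; have [e'y _] := Vy.
have exy : e ** (x ** y) = x ** y.
  have := hconj_mul_polarized x y (hconj e); rewrite e'y hconjK.
  rewrite (peirce_polar_conj eI) // scale0r (peirce_hconj eI) // amulNl addrC.
  by move/eqP; rewrite subr_eq0 => /eqP.
have eyx : e ** (y ** x) = 0.
  have := hconj_mul_polarized y x (hconj e); rewrite e'x hconjK.
  by rewrite (peirce_polar_e e'I) // scale0r amulx0 add0r.
have := mul_hconj_polarized x one y; rewrite !hmul1x.
rewrite (peirce_hconj eI Ux) (peirce_hconj e'I Vy) !amulNr => h.
have := congr1 (amul H e) h; rewrite amulZr hmulx1 amulBr amulNr exy eyx subr0.
by rewrite scaleNr => <-; rewrite opprK.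
Qed.

Lemma peirceVM e x y : hurwitz_idempotent e ->
  peirce e x -> peirce (hconj e) y -> y ** x = - B x y *: hconj e.
Proof.
move=> eI Ux Vy; rewrite (hpolarC x y).
by apply: (peirceMV (hconj_idempotent eI) Vy); rewrite hconjK.
Qed.

End Peirce.

(** Pairing with [y i] detects [x i] and kills every other vector of the list. *)
Lemma dual_free (F : fieldType) (H : hurwitz F) (J : eqType) (x y : J -> H)
    (s : seq J) (r : seq H) :
  uniq s -> {in s &, forall i j, hpolar (x i) (y j) = (i == j)%:R} ->
  (forall z j, z \in r -> j \in s -> hpolar z (y j) = 0) -> free r ->
  free (map x s ++ r).
Proof.
move=> + + + fr; elim: s => //= i s IH /andP[is_ us] xy ry.
rewrite free_cons IH // => [|j k js ks|z j zr js]; first last.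
- by apply: ry; rewrite // inE js orbT.
- by apply: xy; rewrite inE ?js ?ks orbT.
rewrite andbT; apply/negP => xi; have := xy i i (mem_head _ _) (mem_head _ _).
rewrite eqxx; suff -> : hpolar (x i) (y i) = 0.
  by move/eqP; rewrite eq_sym oner_eq0.
move: xi; apply: (span_ind (P := fun z => hpolar z (y i) = 0)).
- by move=> k a b ha hb; rewrite hpolarPl ha hb mulr0 addr0.
- exact: hpolar0l.
move=> z; rewrite mem_cat => /orP[/mapP [j js ->]|zr].
  rewrite xy ?inE ?eqxx ?js ?orbT //.
  by case: eqP js is_ => [->|//] ->.
by apply: ry; rewrite ?mem_head.
Qed.

(** * Peirce frames and the gradings they carry *)

Section PeirceFrames.
Variables (F : fieldType) (H : hurwitz F).
Hypothesis dimH : (1 < \dim {:H})%N.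
Variables (J : finType) (e : H) (u v : J -> H).
Local Notation e' := (hconj e).

(** The index type is [unit] in the quaternion case and ['Z_3] in the Cayley case, so that the
    3-grading and the Cartan grading share one construction. *)
Definition peirce_frame :=
  [/\ hurwitz_idempotent e, forall j, peirce e (u j),
      forall j, peirce (hconj e) (v j) &
      forall i j, hpolar (u i) (v j) = (i == j)%:R].

Hypothesis frame : peirce_frame.

Lemma frame_mul_uv i j : u i ** v j = if i == j then - e else 0.
Proof.
have [eI Uu Vv uv] := frame; rewrite (peirceMV dimH eI) // uv.
by case: eqP => _; rewrite ?scaleN1r // oppr0 scale0r.
Qed.

Lemma frame_mul_vu i j : v i ** u j = if i == j then - e' else 0.
Proof.
have [eI Uu Vv uv] := frame; rewrite (peirceVM dimH eI) // uv eq_sym.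
by case: eqP => _; rewrite ?scaleN1r // oppr0 scale0r.
Qed.

Lemma frame_free (s : seq J) :
  uniq s -> free (e :: e' :: map u s ++ map v s).
Proof.
move=> us; have [eI Uu Vv uv] := frame; have e'I := hconj_idempotent eI.
have uu i j : hpolar (u i) (u j) = 0 by apply: (peirce_polar eI).
have vv i j : hpolar (v i) (v j) = 0 by apply: (peirce_polar e'I).
have fv : free (map v s).
  rewrite -[map v s]cats0; apply: (@dual_free _ _ _ v u) => //.
    by move=> i j _ _; rewrite hpolarC uv eq_sym.
  by rewrite nil_free.
have fuv : free (map u s ++ map v s).
  apply: (@dual_free _ _ _ u v) => //.
  by move=> _ j /mapP [i _ ->] _.
(* The idempotents e and e' are isotropic and pair to 1, so each is dual to the other. *)
pose x (b : bool) := if b then e else e'.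
apply: (@dual_free _ _ _ x (x \o negb) [:: true; false]) => //.
  have ee' := idempotent_polar dimH eI.
  move=> [] [] _ _ /=; rewrite ?ee' ?(idempotent_polar_self eI) //.
    by rewrite (idempotent_polar_self e'I).
  by rewrite hpolarC.
move=> z b zr _; rewrite /= /x; move: zr.
rewrite mem_cat => /orP[] /mapP [i _ ->]; case: b => /=.
- exact: (peirce_polar_conj eI).
- exact: (peirce_polar_e eI).
- exact: (peirce_polar_e e'I).
- by rewrite -[e]hconjK; apply: (peirce_polar_conj e'I).
Qed.

Lemma frame_basis (s : seq J) : uniq s -> \dim {:H} = (size s).*2.+2 ->
  basis_of fullv (e :: e' :: map u s ++ map v s).
Proof.
move=> us dimE; rewrite basisEfree frame_free //= subvf size_cat !size_map.
by rewrite dimE addnn leqnn.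
Qed.

Section FrameGrading.
Variables (G : zmodType) (d : J -> G).

Definition frame_component (k : option (bool * J)) : {vspace H} :=
  match k with
  | None => <<[:: e; e']>>%VS
  | Some (true, j) => <[u j]>%VS
  | Some (false, j) => <[v j]>%VS
  end.

Definition frame_degree (k : option (bool * J)) : G :=
  match k with
  | None => 0
  | Some (true, j) => d j
  | Some (false, j) => - d j
  end.

Definition frame_grading : G -> {vspace H} :=
  components_by_degree frame_component frame_degree.

Hypothesis deg_inj : injective frame_degree.
Hypothesis dimE : \dim {:H} = #|J|.*2.+2.
Hypothesis uu : forall i j, u i ** u j = 0 \/
  exists2 k, u i ** u j \in <[v k]>%VS & d i + d j = - d k.
Hypothesis vv : forall i j, v i ** v j = 0 \/
  exists2 k, v i ** v j \in <[u k]>%VS & d i + d j = - d k.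

Lemma frame_gradingE k : frame_grading (frame_degree k) = frame_component k.
Proof. exact: components_deg. Qed.

Lemma frame_grading0 : frame_grading 0 = <<[:: e; e']>>%VS.
Proof. exact: (frame_gradingE None). Qed.
Lemma frame_grading_u j : frame_grading (d j) = <[u j]>%VS.
Proof. exact: (frame_gradingE (Some (true, j))). Qed.
Lemma frame_grading_v j : frame_grading (- d j) = <[v j]>%VS.
Proof. exact: (frame_gradingE (Some (false, j))). Qed.

Lemma mem_frame_grading0 a b : a *: e + b *: e' \in frame_grading 0.
Proof.
by rewrite frame_grading0 span_cons span_seq1 memv_add // memvZ // memv_line.
Qed.

Lemma frame_grading0P x : x \in frame_grading 0 ->
  exists a b, x = a *: e + b *: e'.
Proof.
rewrite frame_grading0 span_cons span_seq1.
by move=> /memv_addP[_ /vlineP[a ->] [_ /vlineP[b ->] ->]]; exists a, b.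
Qed.

Lemma frame_is_grading : is_grading frame_grading.
Proof.
have [eI Uu Vv uv] := frame; have e'I := hconj_idempotent eI.
have cards : \dim {:H} = (size (enum J)).*2.+2 by rewrite -cardE.
have [/eqP full _] := andP (frame_basis (enum_uniq J) cards).
apply: components_grading => //.
- rewrite -full; apply/span_subvP => x.
  have sup k : (frame_component k <= \sum_i frame_component i)%VS.
    by rewrite (sumv_sup k).
  rewrite !inE mem_cat => /or4P[/eqP->|/eqP->|/mapP[j _ ->]|/mapP[j _ ->]].
  + by apply: subvP (sup None) _ _; rewrite memv_span ?inE ?eqxx.
  + by apply: subvP (sup None) _ _; rewrite memv_span ?inE ?eqxx ?orbT.
  + by apply: subvP (sup (Some (true, j))) _ _; rewrite memv_line.
  + by apply: subvP (sup (Some (false, j))) _ _; rewrite memv_line.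
(* One dimension for each of the 2 #|J| + 1 indices and one more for [None], whose component is
   spanned by two vectors. *)
- have comp1 k : (\dim (frame_component k) <= 1 + (k == None))%N.
    case: k => [[[] j]|] /=; rewrite ?dim_vline; try by case: (_ == _).
    exact: dim_span.
  apply: leq_trans (leq_sum _ (fun k _ => comp1 k)) _.
  rewrite big_split /= sum1_card card_option card_prod card_bool dimE mul2n.
  by rewrite (bigD1 None) //= big1 ?addn0 ?addn1 // => k /negPf ->.
have e0 : e \in frame_grading 0.
  by have := mem_frame_grading0 1 0; rewrite scale1r scale0r addr0.
have e'0 : e' \in frame_grading 0.
  by have := mem_frame_grading0 0 1; rewrite scale1r scale0r add0r.
have ee := idempotent_sqr dimH eI; have e'e' := idempotent_sqr dimH e'I.
have ee' := idempotent_mul_conj dimH eI.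
have e'e := idempotent_conj_mul dimH eI.
have Pu j := peirceP dimH eI (Uu j); have Pv j := peirceP dimH e'I (Vv j).
rewrite hconjK in Pv.
have frame_mulN (i j : option (bool * J)) x y : x \in frame_component i ->
    y \in frame_component j -> (i == None) || (j == None) ->
    x ** y \in frame_grading (frame_degree i + frame_degree j).
  move: i j => [[b i]|] [[b' j]|] //=.
  - move=> xi; rewrite -frame_grading0 addr0 => /frame_grading0P[k [l ->]] _.
    rewrite amulDr !amulZr; case: b xi => /= /vlineP[m ->]; rewrite !amulZl.
      have [_ -> _ ->] := Pu i; rewrite !scaler0 add0r frame_grading_u.
      by rewrite !memvZ ?memv_line.
    have [_ -> _ ->] := Pv i; rewrite !scaler0 addr0 frame_grading_v.
    by rewrite !memvZ ?memv_line.
  - rewrite -frame_grading0 add0r => /frame_grading0P[k [l ->]] + _.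
    rewrite amulDl !amulZl; case: b' => /= /vlineP[m ->]; rewrite !amulZr.
      have [-> _ -> _] := Pu j; rewrite !scaler0 addr0 frame_grading_u.
      by rewrite !memvZ ?memv_line.
    have [-> _ -> _] := Pv j; rewrite !scaler0 add0r frame_grading_v.
    by rewrite !memvZ ?memv_line.
  - rewrite -frame_grading0 addr0 => /frame_grading0P[k [l ->]].
    move=> /frame_grading0P[m [n ->]] _; rewrite amulDl !amulDr !amulZl !amulZr.
    by rewrite ee ee' e'e e'e' !scaler0 addr0 add0r !scalerA mem_frame_grading0.
move=> i j x y xi yj.
have [/frame_mulN|] := boolP ((i == None) || (j == None)); first by apply.
move: i j xi yj => [[b i]|] [[b' j]|] //=.
case: b b' => [] [] /vlineP[k ->] /vlineP[l ->] _;
  rewrite amulZl amulZr 2?memvZ // -/frame_grading.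
- have [->|[m uij ->]] := uu i j; first exact: mem0v.
  by rewrite frame_grading_v.
- rewrite frame_mul_uv; case: eqP => [->|_]; last exact: mem0v.
  by rewrite subrr rpredN.
- rewrite frame_mul_vu; case: eqP => [->|_]; last exact: mem0v.
  by rewrite addNr rpredN.
- have [->|[m vij dm]] := vv i j; first exact: mem0v.
  by rewrite -opprD dm opprK frame_grading_u.
Qed.

Lemma frame_refines (K : zmodType) (Gamma : K -> {vspace H}) :
  e \in Gamma 0 -> e' \in Gamma 0 ->
  (forall j, homogeneous Gamma (u j)) -> (forall j, homogeneous Gamma (v j)) ->
  refines frame_grading Gamma.
Proof.
move=> e0 e'0 ug vg; apply: components_refines => // -[[[] j]|] /=.
- by have [k ?] := ug j; exists k; rewrite -memvE.
- by have [k ?] := vg j; exists k; rewrite -memvE.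
- exists 0; apply/span_subvP => x.
  by rewrite !inE => /orP[] /eqP ->.
Qed.

Lemma frame_neq0 : [/\ e != 0, forall j, u j != 0 & forall j, v j != 0].
Proof.
have [eI _ _ uv] := frame; split=> [|j|j]; apply/eqP => z.
- have := eI.2; rewrite z /htrace hpolar0l => /eqP.
  by rewrite eq_sym oner_eq0.
- by have /eqP := uv j j; rewrite z hpolar0l eqxx eq_sym oner_eq0.
- by have /eqP := uv j j; rewrite z hpolar0r eqxx eq_sym oner_eq0.
Qed.

Lemma frame_in_support g : in_support frame_grading g ->
  [\/ g = 0, exists j, g = d j | exists j, g = - d j].
Proof.
have [[k ->]|D0] := components_cases frame_component frame_degree g; last first.
  by rewrite /in_support /frame_grading D0 eqxx.
case: k => [[[] j]|] _; first by constructor 2; exists j.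
  by constructor 3; exists j.
by constructor 1.
Qed.

Lemma frame_degree_support k : in_support frame_grading (frame_degree k).
Proof.
have [e0 u0 v0] := frame_neq0; rewrite /in_support frame_gradingE.
case: k => [[[] j]|] /=; rewrite -dimv_eq0 ?dim_vline ?u0 ?v0 //.
rewrite dimv_eq0; apply: contraNneq e0 => s0.
by rewrite -memv0 -s0 memv_span ?inE ?eqxx.
Qed.

Section Relations.
Hypothesis grF : is_grading frame_grading.
Variables (K : zmodType) (f : G -> K).
Hypothesis f_rel : forall g1 g2 g3,
  support_relation frame_grading g1 g2 g3 -> f g1 + f g2 = f g3.

Lemma frame_relation g h x y : x \in frame_grading g -> y \in frame_grading h ->
  x ** y != 0 -> f g + f h = f (g + h).
Proof.
move=> xg yh xy0; apply: f_rel; have [_ _ grM] := grF.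
by split=> [|a b]; [exists x, y|apply: grM].
Qed.

Lemma frame_relation0 : f 0 = 0.
Proof.
have [eI _ _ _] := frame; have [e0 _ _] := frame_neq0.
have e0' : e \in frame_grading 0.
  by have := mem_frame_grading0 1 0; rewrite scale1r scale0r addr0.
apply: (addrI (f 0)); rewrite (frame_relation e0' e0') ?addr0 //.
by rewrite (idempotent_sqr dimH eI).
Qed.

Lemma frame_relationN j : f (- d j) = - f (d j).
Proof.
have [e0 _ _] := frame_neq0.
apply/eqP; rewrite -addr_eq0 addrC; apply/eqP.
rewrite -frame_relation0 -(subrr (d j)); apply: (@frame_relation _ _ (u j) (v j)).
- by rewrite frame_grading_u memv_line.
- by rewrite frame_grading_v memv_line.
- by rewrite frame_mul_uv eqxx oppr_eq0.
Qed.

End Relations.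

End FrameGrading.
End PeirceFrames.

Lemma frame_super (F : fieldType) (H : hurwitz F) (M : 'Z_2 -> {vspace H})
    (Mgr : is_grading M) (J : finType) (e : H) (u v : J -> H) (G : zmodType)
    (d : J -> G) (sg : J -> 'Z_2) :
  injective (frame_degree d) -> is_grading (frame_grading e u v d) ->
  e \in M 0 -> hconj e \in M 0 -> (forall j, u j \in M (sg j)) ->
  (forall j, v j \in M (sg j)) ->
  let sgo k := if k is Some (_, j) then sg j else 0 in
  @is_super_grading F (Superalgebra Mgr) G (frame_grading e u v d) /\
  forall k, (frame_grading e u v d (frame_degree d k) :&: M (sgo k))%VS =
    frame_component e u v k.
Proof.
move=> deg_inj gr e0 e'0 uM vM sgo.
have sub k : (frame_component e u v k <= M (sgo k))%VS.
  case: k => [[[] j]|] /=; rewrite -?memvE //.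
  by apply/span_subvP => x; rewrite !inE => /orP[] /eqP ->.
split; first exact: (@components_super _ (Superalgebra Mgr) _ _ _ _ sgo).
by move=> k; apply: (@components_sector _ (Superalgebra Mgr)).
Qed.

Lemma ord3_cases (i : 'Z_3) : [\/ i = 1, i = 2%:R | i = 3%:R].
Proof.
case: i => [[|[|[|//]]] ?]; [constructor 3|constructor 1|constructor 2];
  exact: val_inj.
Qed.

Lemma frame_degree_inj (J : finType) (G : zmodType) (d : J -> G) :
  injective d -> (forall j, d j != 0) -> (forall i j, d i != - d j) ->
  injective (frame_degree d).
Proof.
move=> dI d0 dN; have opp_eq i j : - d i != d j by rewrite eq_sym dN.
have zero_eq j : 0 != d j by rewrite eq_sym.
have zero_oppeq j : 0 != - d j by rewrite eq_sym oppr_eq0.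
move=> [[[] i]|] [[[] j]|] //= /eqP; rewrite ?oppr_eq0 ?eqr_opp.
all: by rewrite ?(negPf (dN _ _)) ?(negPf (opp_eq _ _)) ?(negPf (d0 _))
  ?(negPf (zero_eq _)) ?(negPf (zero_oppeq _)) // => /eqP/dI ->.
Qed.

(** * Split quaternions and the 3-grading *)

Section RankOne.
Variables (F : fieldType) (H : hurwitz F).
Hypothesis dimH : \dim {:H} = 4%N.
Variables (e : H) (u v : unit -> H).
Hypothesis frame : peirce_frame e u v.

Let dimH1 : (1 < \dim {:H})%N. Proof. by rewrite dimH. Qed.

Definition degree1 (_ : unit) : int := 1.

Lemma degree1_inj : injective (frame_degree degree1).
Proof. by apply: frame_degree_inj => // -[] []. Qed.

Lemma rank1_grading : is_grading (frame_grading e u v degree1).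
Proof.
have [eI Uu Vv _] := frame; have e'I := hconj_idempotent eI.
apply: (frame_is_grading dimH1 frame degree1_inj).
- by rewrite dimH card_unit.
- by move=> [] []; left; apply: (peirce_sqr dimH1 eI).
- by move=> [] []; left; apply: (peirce_sqr dimH1 e'I).
Qed.

Lemma rank1_universal : universal_grading_group (frame_grading e u v degree1).
Proof.
split=> [g|K f f_rel].
  exists [:: 1], (fun=> g); rewrite big_seq1 /= andbT.
  rewrite (frame_degree_support frame degree1_inj (Some (true, tt))).
  by rewrite intz.
have [phi phiE] := @additive_of _ _ (fun n : int => f 1 *~ n)
  (fun m n => mulrzDr (f 1) m n).
exists phi => g /frame_in_support; rewrite phiE => -[->|[j ->]|[j ->]].
- by rewrite (frame_relation0 dimH1 frame degree1_inj rank1_grading f_rel).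
- by rewrite mulr1z.
- by rewrite (frame_relationN dimH1 frame degree1_inj rank1_grading f_rel) mulrN1z.
Qed.

Lemma rank1_canonical :
  canonical_quaternion_basis e (hconj e) (u tt) (v tt).
Proof.
have [eI Uu Vv _] := frame; have e'I := hconj_idempotent eI.
have [e_u u_e' e'_u u_e] := peirceP dimH1 eI (Uu tt).
have [e'_v v_e e_v v_e'] := peirceP dimH1 e'I (Vv tt).
rewrite hconjK in v_e e_v.
split; first by have := @frame_basis _ _ dimH1 _ _ _ _ frame [:: tt]; apply.
split; split=> //; rewrite ?(frame_mul_uv dimH1 frame) ?(frame_mul_vu dimH1 frame) //.
- exact: idempotent_sqr.
- exact: idempotent_sqr.
- exact: idempotent_mul_conj.
- exact: idempotent_conj_mul.
- exact: (peirce_sqr dimH1 eI).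
- exact: (peirce_sqr dimH1 e'I).
Qed.

End RankOne.

(** * Split Cayley algebras and the Cartan grading *)

Section RankTwo.
Variables (F : fieldType) (H : hurwitz F).
Hypothesis dimH : \dim {:H} = 8%N.
Variables (e : H) (u : 'Z_3 -> H).
Hypothesis eI : hurwitz_idempotent e.
Hypothesis Uu : forall i, peirce e (u i).
Hypothesis u123 : hpolar (u 1 ** u 2%:R) (u 3%:R) = 1.

Let dimH1 : (1 < \dim {:H})%N. Proof. by rewrite dimH. Qed.

(** The canonical relation [u i ** u (i + 1) = v (i + 2)], shifted by one modulo 3, leaves no other
    choice for v. *)
Definition cross (i : 'Z_3) : H := u (i + 1) ** u (i + 2%:R).
Local Notation v := cross.

Lemma hpolar_cross i : hpolar (u i) (v i) = 1.
Proof.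
rewrite hpolarC /v; have [->|->|->] := ord3_cases i.
- have -> : 1 + 1 = 2%:R :> 'Z_3 by apply: val_inj.
  have -> : 1 + 2%:R = 3%:R :> 'Z_3 by apply: val_inj.
  by rewrite -(peirce_polar_cyclic dimH1 eI).
- have -> : 2%:R + 1 = 3%:R :> 'Z_3 by apply: val_inj.
  have -> : 2%:R + 2%:R = 1 :> 'Z_3 by apply: val_inj.
  by rewrite (peirce_polar_cyclic dimH1 eI).
- have -> : 3%:R + 1 = 1 :> 'Z_3 by apply: val_inj.
  by have -> : 3%:R + 2%:R = 2%:R :> 'Z_3 by apply: val_inj.
Qed.

Lemma Z3_add_other (i j : 'Z_3) : [\/ j = i, j = i + 1 | j = i + 2%:R].
Proof.
have [->|->|->] := ord3_cases i; have [->|->|->] := ord3_cases j.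
all: by [constructor 1; apply: val_inj|constructor 2; apply: val_inj
  |constructor 3; apply: val_inj].
Qed.

(** For distinct i and j, [u i] is a factor of [cross j], and B (u i) (u i ** x) = N (u i) * B 1 x =
    0. *)
Lemma cross_frame : peirce_frame e u v.
Proof.
split=> // [j|i j]; first exact: peirceM.
have [->|->|->] := Z3_add_other i j.
- by rewrite eqxx hpolar_cross.
- rewrite /v; have -> : i + 1 + 2%:R = i.
    by have [->|->|->] := ord3_cases i; apply: val_inj.
  have -> : (i == i + 1) = false by have [->|->|->] := ord3_cases i.
  rewrite (peirce_anticomm dimH1 eI) // hpolarNr -{1}[u i]hmulx1 hpolarMl.
  by rewrite (peirce_norm eI) // mul0r oppr0.
rewrite /v; have -> : i + 2%:R + 1 = i.
  by have [->|->|->] := ord3_cases i; apply: val_inj.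
have -> : (i == i + 2%:R) = false by have [->|->|->] := ord3_cases i.
by rewrite -{1}[u i]hmulx1 hpolarMl (peirce_norm eI) // mul0r.
Qed.

Lemma cross_mul i : v i ** v (i + 1) = u (i + 2%:R).
Proof.
rewrite /v; have -> : i + 1 + 1 = i + 2%:R.
  by have [->|->|->] := ord3_cases i; apply: val_inj.
have -> : i + 1 + 2%:R = i.
  by have [->|->|->] := ord3_cases i; apply: val_inj.
(* Two sign changes bring the product to the form x ** y ** (z ** x) with x = u (i + 2). As N x = 0,
   [amul_mid] leaves a multiple of x, whose coefficient is 1 by [hpolar_cross]. *)
rewrite (peirce_anticomm dimH1 eI (Uu (i + 1))) // amulNl.
rewrite (peirce_anticomm dimH1 eI (Uu (i + 2%:R)) (Uu i)) amulNr opprK.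
rewrite amul_mid // (peirce_norm eI) // scale0r subr0 hconjM //.
rewrite !(peirce_hconj eI) // amulNl amulNr opprK.
have := hpolar_cross (i + 2%:R); rewrite /v.
have -> : i + 2%:R + 1 = i.
  by have [->|->|->] := ord3_cases i; apply: val_inj.
have -> : i + 2%:R + 2%:R = i + 1.
  by have [->|->|->] := ord3_cases i; apply: val_inj.
by move=> ->; rewrite scale1r.
Qed.

Lemma cross_canonical : canonical_cayley_basis e (hconj e) u v.
Proof.
have e'I := hconj_idempotent eI; have fr := cross_frame.
have [_ _ Vv _] := fr.
have P j := peirceP dimH1 eI (Uu j); have P' j := peirceP dimH1 e'I (Vv j).
rewrite hconjK in P'.
split; first by have := @frame_basis _ _ dimH1 _ _ _ _ fr [:: 1; 2%:R; 3%:R]; apply.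
split.
- split; [exact: idempotent_sqr|exact: idempotent_sqr|
  exact: idempotent_mul_conj|exact: idempotent_conj_mul].
- by move=> i; have [? ? ? ?] := P i; have [? ? ? ?] := P' i.
- by move=> i; have [? ? ? ?] := P i; have [? ? ? ?] := P' i.
- move=> i; have e1 : i + 2%:R + 1 = i.
    by have [->|->|->] := ord3_cases i; apply: val_inj.
  have e2 : i + 2%:R + 2%:R = i + 1.
    by have [->|->|->] := ord3_cases i; apply: val_inj.
  have uuv : u i ** u (i + 1) = v (i + 2%:R) by rewrite /v e1 e2.
  split=> //; last by rewrite (peirce_anticomm dimH1 e'I) // cross_mul.
    by rewrite (peirce_anticomm dimH1 eI) // uuv.
  exact: cross_mul.
- split=> [i|i j].
    by split; [apply: (peirce_sqr dimH1 eI)|apply: (peirce_sqr dimH1 e'I)].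
  by split; [apply: frame_mul_uv|apply: frame_mul_vu].
Qed.

(** Since [u 1 ** u 2 = v 3] has the degree opposite to that of [u 3], the three degrees sum to 0;
    the first two are free generators. *)
Definition degree2 (i : 'Z_3) : int * int :=
  if i == 1 then (1, 0) else if i == 2%:R then (0, 1) else (-1, -1).

Lemma degree2_inj : injective (frame_degree degree2).
Proof.
apply: frame_degree_inj.
- move=> i j; have [->|->|->] := ord3_cases i;
  by have [->|->|->] := ord3_cases j.
- by move=> i; have [->|->|->] := ord3_cases i.
- move=> i j; have [->|->|->] := ord3_cases i;
  by have [->|->|->] := ord3_cases j.
Qed.

Lemma degree2_sum i : degree2 i + degree2 (i + 1) = - degree2 (i + 2%:R).
Proof. by have [->|->|->] := ord3_cases i. Qed.

Lemma rank2_grading : is_grading (frame_grading e u v degree2).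
Proof.
have e'I := hconj_idempotent eI; have fr := cross_frame.
have [_ _ Vv _] := fr.
have [_ [_ _ _ uuvv _]] := cross_canonical.
have e1 i : i + 2%:R + 1 = i :> 'Z_3.
  by have [->|->|->] := ord3_cases i; apply: val_inj.
have e2 i : i + 2%:R + 2%:R = i + 1 :> 'Z_3.
  by have [->|->|->] := ord3_cases i; apply: val_inj.
apply: (frame_is_grading dimH1 fr degree2_inj).
- by rewrite dimH card_ord.
- move=> i j; have [->|->|->] := Z3_add_other i j.
  + by left; apply: (peirce_sqr dimH1 eI).
  + right; exists (i + 2%:R); last exact: degree2_sum.
    by have [-> _ _ _] := uuvv i; rewrite memv_line.
  + right; exists (i + 1); last first.
      by rewrite addrC -{2}[i]e1 degree2_sum e2.
    have [_ + _ _] := uuvv (i + 2%:R); rewrite e1 e2 => ->.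
    by rewrite rpredN memv_line.
- move=> i j; have [->|->|->] := Z3_add_other i j.
  + by left; apply: (peirce_sqr dimH1 e'I).
  + right; exists (i + 2%:R); last exact: degree2_sum.
    by have [_ _ -> _] := uuvv i; rewrite memv_line.
  + right; exists (i + 1); last first.
      by rewrite addrC -{2}[i]e1 degree2_sum e2.
    have [_ _ _] := uuvv (i + 2%:R); rewrite e1 e2 => ->.
    by rewrite rpredN memv_line.
Qed.

Lemma rank2_universal : universal_grading_group (frame_grading e u v degree2).
Proof.
have fr := cross_frame; have [e0 u0 v0] := frame_neq0 fr.
split=> [[a b]|K f f_rel].
  exists [:: (1, 0); (0, 1)], (fun g => if g == (1, 0) then a else b).
  rewrite big_cons big_seq1 /= andbT.
  rewrite (frame_degree_support fr degree2_inj (Some (true, 1))).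
  rewrite (frame_degree_support fr degree2_inj (Some (true, 2%:R))).
  split=> //; apply: injective_projections => /=.
    by rewrite !(raddfMz fst) /= intz mul0rz addr0.
  by rewrite !(raddfMz snd) /= intz mul0rz add0r.
have gr := rank2_grading.
pose phi0 (x : int * int) := f (1, 0) *~ x.1 + f (0, 1) *~ x.2.
have [x y|phi phiE] := @additive_of _ _ phi0.
  by rewrite /phi0 /= !mulrzDr addrACA.
(* The value at the third degree is determined by the first two through the nonzero product
   [u 1 ** u 2 = v 3]. *)
have f3 : f (degree2 3%:R) = - (f (1, 0) + f (0, 1)).
  apply/oppr_inj; rewrite opprK -(frame_relationN dimH1 fr degree2_inj gr f_rel).
  rewrite (frame_relation gr f_rel (x := u 1) (y := u 2%:R)) //.
  - by have -> := frame_grading_u e u v degree2_inj 1; rewrite memv_line.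
  - by have -> := frame_grading_u e u v degree2_inj 2%:R; rewrite memv_line.
  have [_ [_ _ _ /(_ 1)[-> _ _ _] _]] := cross_canonical.
  exact: v0.
have phid j : phi (degree2 j) = f (degree2 j).
  rewrite phiE /phi0; have [->|->|->] := ord3_cases j.
  - by rewrite /= mulr1z mulr0z addr0.
  - by rewrite /= mulr0z mulr1z add0r.
  - by rewrite f3 /= !mulrN1z opprD.
exists phi => g /frame_in_support [->|[j ->]|[j ->]] //.
- by rewrite raddf0 (frame_relation0 dimH1 fr degree2_inj gr f_rel).
- by rewrite raddfN phid (frame_relationN dimH1 fr degree2_inj gr f_rel).
Qed.

End RankTwo.

(** * Cayley-Dickson doubling of gradings *)

Lemma mulv_eltP (F : fieldType) (A : algebra F) (K : {vspace A}) (x y : A) :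
  reflect (exists2 k, k \in K & y = k ** x) (y \in mulv_elt K x).
Proof.
by apply: (iffP memv_imgP) => -[k kK ->]; exists k => //; rewrite lfunE.
Qed.

Lemma mem_mulv_elt (F : fieldType) (A : algebra F) (K : {vspace A}) (x k : A) :
  k \in K -> k ** x \in mulv_elt K x.
Proof. by move=> kK; apply/mulv_eltP; exists k. Qed.

Lemma dim_mulv_elt_le (F : fieldType) (A : algebra F) (K : {vspace A}) (x : A) :
  (\dim (mulv_elt K x) <= \dim K)%N.
Proof. by rewrite -(limg_ker_dim (linfun (applyr (@amul F A) x)) K) leq_addl. Qed.

Section Doubling.
Variables (F : fieldType) (H : hurwitz F).
Hypothesis dimH : (1 < \dim {:H})%N.
Local Notation N := (@hnorm F H).
Local Notation B := (@hpolar F H).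
Local Notation T := (@htrace F H).

Lemma dim_mulv_elt (K : {vspace H}) x : N x != 0 ->
  \dim (mulv_elt K x) = \dim K.
Proof.
move=> Nx; apply: limg_dim_eq; apply/eqP; rewrite -subv0.
apply/subvP => k /memv_capP[_]; rewrite memv_ker lfunE /= => /eqP kx0.
have := mulK_hconj dimH x k; rewrite kx0 amul0x => /eqP.
by rewrite eq_sym scaler_eq0 (negPf Nx) /= memv0.
Qed.

Variable u : H.
Hypothesis Tu : T u = 0.

Lemma hconj_trace0 : hconj u = - u.
Proof. by rewrite hconjE Tu scale0r sub0r. Qed.

Lemma orthogonal_comm a : B u a = 0 -> u ** a = hconj a ** u.
Proof.
move=> ua; have := hconj_mul_polarized dimH a (hone H) u.
rewrite !hmulx1 hconj_trace0 amulNl hpolarC ua scale0r => /eqP.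
by rewrite subr_eq0 => /eqP.
Qed.

Lemma orthogonal_hconj a : B u a = 0 -> B u (hconj a) = 0.
Proof. by move=> ua; rewrite -hpolar_conj hconjK hconj_trace0 hpolarNl ua oppr0. Qed.

(** This and the next two lemmas recover the Cayley-Dickson product with parameter N u.
    Orthogonality is asked only of the elements involved, so they serve both for doubling K by v and
    for doubling the even part by u. *)
Lemma orthogonal_mull a b : B u a = 0 -> B u b = 0 ->
  B u (b ** a) = 0 -> a ** (b ** u) = b ** a ** u.
Proof.
move=> ua ub uba; have ub' := orthogonal_hconj ub.
rewrite -{1}[b]hconjK -orthogonal_comm //.
have := hconj_mul_polarized dimH (hconj a) (hconj b) u.
rewrite hconjK hpolarC orthogonal_hconj // scale0r hconj_trace0 amulNl.
move/eqP; rewrite subr_eq0 => /eqP ->.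
by rewrite -hconjM // orthogonal_comm ?hconjK // orthogonal_hconj.
Qed.

Lemma orthogonal_mulr a b : B u b = 0 -> a ** u ** b = a ** hconj b ** u.
Proof.
move=> ub; have := mul_hconj_polarized dimH u a (hconj b).
rewrite hconjK orthogonal_hconj // scale0r hconj_trace0 amulNr => /eqP.
by rewrite subr_eq0 => /eqP.
Qed.

Lemma orthogonal_mulm a b : B u a = 0 -> B u (hconj b ** a) = 0 ->
  a ** u ** (b ** u) = - N u *: (hconj b ** a).
Proof.
move=> ua uba; rewrite -{1}[a]hconjK -orthogonal_comm ?orthogonal_hconj //.
rewrite amul_mid // hconjM // hconjK uba scale0r sub0r.
by rewrite scaleNr.
Qed.

Variables (G : zmodType) (P : G -> {vspace H}).
Hypothesis orthP : forall g a, a \in P g -> B u a = 0.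
Hypothesis conjP : forall g a, a \in P g -> hconj a \in P g.
Hypothesis mulP : forall g h a b, a \in P g -> b \in P h -> a ** b \in P (g + h).

(** Doubling can be iterated: [doubled_conj] and [doubled_mul] restore the closure hypotheses on P,
    now for the group G * 'Z_2. *)
Definition doubled (x : G * 'Z_2) : {vspace H} :=
  if x.2 == 0 then P x.1 else mulv_elt (P x.1) u.

Lemma doubled_conj x a : a \in doubled x -> hconj a \in doubled x.
Proof.
rewrite /doubled; case: ifP => _; first exact: conjP.
move=> au; rewrite hconjE; suff -> : T a = 0.
  by rewrite scale0r sub0r rpredN.
have /mulv_eltP [k kP ->] := au.
by rewrite htraceM hconj_trace0 hpolarNr hpolarC (orthP kP) oppr0.
Qed.

Lemma doubled_mul x y a b : a \in doubled x -> b \in doubled y ->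
  a ** b \in doubled (x + y).
Proof.
case: x y => [g i] [h j]; rewrite /doubled /=.
have [->|->] := ord2_cases i; have [->|->] := ord2_cases j => /=.
- exact: mulP.
- move=> ag /mulv_eltP[k kh ->]; have kag := mulP kh ag.
  rewrite orthogonal_mull ?(orthP ag) ?(orthP kh) ?(orthP kag) //.
  by rewrite addrC mem_mulv_elt.
- move=> /mulv_eltP[k kg ->] bh; rewrite orthogonal_mulr ?(orthP bh) //.
  by rewrite mem_mulv_elt // mulP ?conjP.
- move=> /mulv_eltP[k kg ->] /mulv_eltP[l lh ->].
  have lk := mulP (conjP lh) kg.
  by rewrite orthogonal_mulm ?(orthP kg) ?(orthP lk) // addrC memvZ.
Qed.

End Doubling.

(** * Even and odd parts, and the anisotropic doubling *)

Section SuperHurwitz.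
Variables (F : fieldType) (H : hurwitz F) (M : 'Z_2 -> {vspace H}).
Hypothesis Mgr : is_grading M.
Hypothesis dimH : (1 < \dim {:H})%N.
Local Notation N := (@hnorm F H).
Local Notation B := (@hpolar F H).
Local Notation T := (@htrace F H).
Local Notation one := (hone H).

Lemma even_one : one \in M 0. Proof. exact: graded_one. Qed.

Lemma super_mul i j x y : x \in M i -> y \in M j -> x ** y \in M (i + j).
Proof. by case: Mgr => _ _; apply. Qed.

Lemma super_conj i x : x \in M i -> hconj x \in M i.
Proof. exact: graded_conj. Qed.

Lemma super_polar i x y : x \in M i -> y \in M (1 - i) -> B x y = 0.
Proof.
by move=> xi yi; apply: (graded_polar Mgr dimH xi yi); rewrite addrC subrK.
Qed.

Lemma odd_trace x : x \in M 1 -> T x = 0.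
Proof. by move=> x1; apply: (graded_trace Mgr dimH x1). Qed.

Lemma odd_even_polar u x : u \in M 1 -> x \in M 0 -> B u x = 0.
Proof. by move=> u1 x0; apply: (super_polar u1); rewrite subrr. Qed.

Lemma super_sum : (M 0%R + M 1%R)%VS = fullv.
Proof.
apply/eqP; rewrite eqEsubv subvf; apply/subvP => x _.
move: x; apply: (grading_ind Mgr) => [|x y xM yM|i x xi].
- exact: mem0v.
- exact: rpredD.
- have [ei|ei] := ord2_cases i; rewrite ei in xi.
    by apply: subvP (addvSl _ _) _ xi.
  by apply: subvP (addvSr _ _) _ xi.
Qed.

Lemma super_cap : (M 0%R :&: M 1%R)%VS = 0%VS.
Proof.
apply/eqP; rewrite -subv0; apply/subvP => x /memv_capP[x0 x1].
rewrite memv0; apply/negP => /negP xn.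
by have := grading_inj Mgr x0 x1 xn.
Qed.

Lemma super_dim : (\dim (M 0%R) + \dim (M 1%R))%N = \dim {:H}.
Proof. by rewrite -super_sum dimv_disjoint_sum // super_cap. Qed.

Lemma odd_mulv_elt u : u \in M 1 -> N u != 0 ->
  \dim (M 0) = \dim (M 1) -> mulv_elt (M 0) u = M 1.
Proof.
move=> u1 Nu d01; apply/eqP; rewrite eqEdim (dim_mulv_elt dimH) // d01 leqnn.
rewrite andbT; apply/subvP => _ /mulv_eltP[k k0 ->].
by have := super_mul k0 u1; rewrite add0r.
Qed.

Section QuarterGrading.
Variables (w v u : H).
Hypotheses (dimM0 : \dim (M 0) = 4%N) (dimM1 : \dim (M 1) = 4%N).
Hypothesis T1 : T one = 0.
Hypotheses (wM : w \in M 0) (vM : v \in M 0) (uM : u \in M 1).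
Hypotheses (Tw : T w != 0) (vw : B v w = 0) (Tv : T v = 0).
Hypotheses (Nv : N v != 0) (Nu : N u != 0).

Definition quadratic_subalgebra : {vspace H} := (<[one]> + <[w]>)%VS.
Local Notation K := quadratic_subalgebra.

Lemma quadP x : reflect (exists a b, x = a *: one + b *: w) (x \in K).
Proof.
apply: (iffP memv_addP) => [[_ /vlineP[a ->] [_ /vlineP[b ->] ->]]|[a [b ->]]].
  by exists a, b.
exists (a *: one); first by rewrite memvZ ?memv_line.
by exists (b *: w); rewrite ?memvZ ?memv_line.
Qed.

Lemma quad_one : one \in K.
Proof. by apply/quadP; exists 1, 0; rewrite scale1r scale0r addr0. Qed.
Lemma quad_w : w \in K.
Proof. by apply/quadP; exists 0, 1; rewrite scale1r scale0r add0r. Qed.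

Lemma quad_conj x : x \in K -> hconj x \in K.
Proof. by move=> xK; rewrite hconjE rpredB // memvZ // quad_one. Qed.

Lemma quad_mul x y : x \in K -> y \in K -> x ** y \in K.
Proof.
move=> /quadP[a [b ->]] yK; rewrite amulDl !amulZl hmul1x.
rewrite rpredD ?memvZ //; case/quadP: yK => c [d ->].
rewrite amulDr !amulZr hmulx1 (hsqrE dimH).
by rewrite rpredD ?memvZ ?quad_w // rpredB ?memvZ ?quad_w ?quad_one.
Qed.

(** As B 1 1 = 0, the Gram matrix of 1 and w has determinant - T(w)^2, which is nonzero. *)
Lemma quad_radical x : x \in K -> (forall y, y \in K -> B x y = 0) -> x = 0.
Proof.
move=> /quadP[a [b ->]] h.
have := h one quad_one; rewrite hpolarDl !hpolarZl -/(T one) T1 mulr0 add0r.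
move/eqP; rewrite mulf_eq0 (negPf Tw) orbF => /eqP b0.
have := h w quad_w; rewrite b0 scale0r addr0 hpolarZl hpolarC -/(T w) => /eqP.
by rewrite mulf_eq0 (negPf Tw) orbF => /eqP ->; rewrite scale0r.
Qed.

Lemma quad_direct : directv (<[one]> + <[w]>).
Proof.
rewrite directv_addE !directv_trivial /=; apply/eqP.
apply/eqP; rewrite -subv0; apply/subvP => _ /memv_capP[/vlineP[a ->]].
move=> /vlineP[b ab]; have := congr1 T ab.
rewrite /htrace !hpolarZl -!/(T _) T1 mulr0 => /esym/eqP.
rewrite mulf_eq0 (negPf Tw) orbF => /eqP b0.
by rewrite ab b0 scale0r mem0v.
Qed.

Lemma quad_dim : \dim K = 2%N.
Proof.
have w0 : w != 0 by apply: contraNneq Tw => ->; rewrite /htrace hpolar0l.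
by rewrite (directvP quad_direct) /= !dim_vline hone_neq0 w0.
Qed.

Lemma quad_sub : (K <= M 0%R)%VS.
Proof. by rewrite subv_add -!memvE even_one. Qed.

Lemma quad_v_polar k : k \in K -> B v k = 0.
Proof.
by move=> /quadP[a [b ->]]; rewrite hpolarDr !hpolarZr vw -/(T v) Tv !mulr0 addr0.
Qed.

(** Kv is orthogonal to K, and the polar form is nondegenerate on K. *)
Lemma quad_v_cap : (K :&: mulv_elt K v)%VS = 0%VS.
Proof.
apply/eqP; rewrite -subv0; apply/subvP => x /memv_capP[xK /mulv_eltP[k kK e]].
rewrite memv0; apply/eqP; apply: quad_radical => // y yK.
rewrite e hpolar_adjl quad_v_polar // quad_mul //; exact: quad_conj.
Qed.

Lemma quad_v_sum : (K + mulv_elt K v)%VS = M 0.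
Proof.
apply/eqP; rewrite eqEdim dimv_disjoint_sum ?quad_v_cap //.
rewrite (dim_mulv_elt dimH) // quad_dim dimM0 leqnn andbT.
rewrite subv_add quad_sub; apply/subvP => _ /mulv_eltP[k /(subvP quad_sub) k0 ->].
by have := super_mul k0 vM; rewrite addr0.
Qed.

(* K carries the grading by the trivial group 'I_1, doubled by v and then by u. *)
Definition quarter (x : 'Z_2 * 'Z_2) : {vspace H} :=
  doubled u (doubled v (fun _ : 'I_1 => K)) (0, x.1, x.2).

Lemma quarterE i j : quarter (i, j) =
  let L := if i == 0 then K else mulv_elt K v in
  if j == 0 then L else mulv_elt L u.
Proof. by []. Qed.

Lemma doubled_quad_even x a : a \in doubled v (fun _ : 'I_1 => K) x -> a \in M 0.
Proof.
rewrite -quad_v_sum /doubled; case: ifP => _ aK.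
  by apply: subvP (addvSl _ _) _ aK.
by apply: subvP (addvSr _ _) _ aK.
Qed.

Lemma quarter_mul x y a b : a \in quarter x -> b \in quarter y ->
  a ** b \in quarter (x + y).
Proof.
move=> aq bq.
have vK (g : 'I_1) k : k \in K -> B v k = 0 by apply: quad_v_polar.
have Kc (g : 'I_1) k : k \in K -> hconj k \in K by apply: quad_conj.
have Km (g h : 'I_1) k l : k \in K -> l \in K -> k ** l \in K by apply: quad_mul.
have uo g c : c \in doubled v (fun _ : 'I_1 => K) g -> B u c = 0.
  by move=> /doubled_quad_even; apply: odd_even_polar.
apply: (doubled_mul dimH (odd_trace uM) uo _ _ aq bq).
  by move=> g c; apply: (doubled_conj Tv vK Kc).
by move=> g h c d; apply: (doubled_mul dimH Tv vK Kc Km).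
Qed.

Definition quarter_grading := components_by_degree quarter id.

Lemma quarter_gradingE x : quarter_grading x = quarter x.
Proof. exact: (components_deg quarter (@inj_id _) x). Qed.

Lemma quarter_sub x : (quarter x <= M x.2)%VS.
Proof.
case: x => i j; rewrite /quarter {1}/doubled /=.
have [->|->] := ord2_cases j => /=.
  by apply/subvP => a; apply: doubled_quad_even.
apply/subvP => _ /mulv_eltP[k /doubled_quad_even k0 ->].
by have := super_mul k0 uM; rewrite add0r.
Qed.

Lemma quarter_full : (fullv <= \sum_x quarter x)%VS.
Proof.
have sup x : (quarter x <= \sum_y quarter y)%VS by rewrite (sumv_sup x).
rewrite -super_sum subv_add; apply/andP; split.
  by rewrite -quad_v_sum subv_add (sup (0, 0)) (sup (1, 0)).
rewrite -(odd_mulv_elt uM Nu) ?dimM0 ?dimM1 //.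
apply/subvP => _ /mulv_eltP[x x0 ->].
move: x0; rewrite -quad_v_sum => /memv_addP[a aK [b bK ->]].
rewrite amulDl rpredD //.
  by apply: subvP (sup (0, 1)) _ _; rewrite quarterE mem_mulv_elt.
by apply: subvP (sup (1, 1)) _ _; rewrite quarterE mem_mulv_elt.
Qed.

Lemma quarter_is_grading : is_grading quarter_grading.
Proof.
apply: components_grading => //; first exact: quarter_full.
  have dimq x : (\dim (quarter x) <= 2)%N.
    rewrite -quad_dim; case: x => i j; rewrite quarterE /=.
    have dL : (\dim (if i == 0%R then K else mulv_elt K v) <= \dim K)%N.
      by case: ifP => _ //; apply: dim_mulv_elt_le.
    by case: ifP => _ //; apply: leq_trans (dim_mulv_elt_le _ _) dL.
  apply: leq_trans (leq_sum _ (fun x _ => dimq x)) _.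
  by rewrite sum_nat_const card_prod !card_ord -super_dim dimM0 dimM1.
move=> x y a b ax bx; rewrite -[components_by_degree _ _ _]/(quarter_grading _).
by rewrite quarter_gradingE; apply: quarter_mul.
Qed.

Lemma quarter_super : @is_super_grading F (Superalgebra Mgr) _ quarter_grading.
Proof.
apply: (@components_super _ (Superalgebra Mgr) _ _ _ _ snd) => //.
  exact: quarter_is_grading.
exact: quarter_sub.
Qed.

Lemma quarter_sector i j :
  (quarter_grading (i, j) :&: M j)%VS = quarter (i, j).
Proof. by rewrite quarter_gradingE; apply/capv_idPl/quarter_sub. Qed.

Lemma quarter_universal : universal_grading_group quarter_grading.
Proof.
apply: nonisotropic_universal; first exact: quarter_is_grading.
move=> [i j]; exists (((if i == 0 then one else v) : H) **
  (if j == 0 then one else u)).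
  rewrite quarter_gradingE quarterE.
  have vK : v \in mulv_elt K v.
    by have := mem_mulv_elt v quad_one; rewrite hmul1x.
  case: ifP => _; case: ifP => _ /=; rewrite ?hmulx1 ?mem_mulv_elt ?quad_one //.
rewrite hnormM; case: ifP => _; case: ifP => _;
  by rewrite ?hnorm1 ?mulr1 ?mul1r ?mulf_neq0 ?oner_eq0.
Qed.

Lemma quarter_refines (G : zmodType) (Gamma : G -> {vspace H}) g h :
  is_grading Gamma -> w \in Gamma 0 -> v \in Gamma g -> u \in Gamma h ->
  refines quarter_grading Gamma.
Proof.
move=> grG w0 vg uh; have [_ _ grM] := grG.
have K0 : (K <= Gamma 0%R)%VS by rewrite subv_add -!memvE (graded_one grG).
apply: components_refines => // -[i j].
have [k Lk] : exists k,
    ((if i == 0%R then K else mulv_elt K v) <= Gamma k)%VS.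
  case: ifP => _; first by exists 0.
  exists (0 + g); apply/subvP => _ /mulv_eltP[l /(subvP K0) lK ->].
  exact: grM.
rewrite quarterE /=; case: (j == 0); first by exists k.
exists (k + h); apply/subvP => _ /mulv_eltP[l /(subvP Lk) lK ->].
exact: grM.
Qed.

(** Iterated doubling yields (Kv)u. Since k ** (v ** u) = hconj k ** v ** u, the two spaces are
    matched by conjugation, which preserves K. *)
Lemma quarter11 : mulv_elt (mulv_elt K v) u = mulv_elt K (v ** u).
Proof.
have uo x : x \in M 0 -> B u x = 0 by apply: odd_even_polar.
have Kv k : k \in K -> k ** v \in M 0.
  move=> /(subvP quad_sub) k0.
  by have := super_mul k0 vM; rewrite addr0.
have mulE k : k \in K -> k ** (v ** u) = hconj k ** v ** u.
  move=> kK; have k0 := subvP quad_sub _ kK.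
  rewrite (orthogonal_mull dimH (odd_trace uM)) ?uo //.
    by rewrite -(orthogonal_comm dimH Tv) // quad_v_polar.
  by have := super_mul vM k0; rewrite addr0.
apply/vspaceP => x; apply/mulv_eltP/mulv_eltP.
  move=> [_ /mulv_eltP[k kK ->] ->]; exists (hconj k); first exact: quad_conj.
  by rewrite mulE ?quad_conj // hconjK.
move=> [k kK ->]; exists (hconj k ** v); last exact: mulE.
by rewrite mem_mulv_elt ?quad_conj.
Qed.

End QuarterGrading.
End SuperHurwitz.

(** * Fine gradings on a Hurwitz superalgebra *)

Section PeirceProjection.
Variables (F : fieldType) (H : hurwitz F).
Hypothesis dimH : (1 < \dim {:H})%N.
Local Notation N := (@hnorm F H).
Local Notation B := (@hpolar F H).
Local Notation T := (@htrace F H).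
Variable e : H.
Hypothesis eI : hurwitz_idempotent e.
Local Notation e' := (hconj e).

Definition peirce_proj (x : H) := e ** x ** e'.

Lemma idempotent_mul_e x : e ** (e ** x) = e ** x.
Proof. by rewrite amulKl // eI.1 eI.2 scale1r scale0r subr0. Qed.

(** [hconj e] is a combination of 1 and e, so the alternative laws make the bracketing
    immaterial. *)
Lemma peirce_proj_assoc x : peirce_proj x = e ** (x ** e').
Proof.
apply/eqP; rewrite -subr_eq0 -/(associator e x e') hconjE -addrC -scaleN1r.
rewrite associatorPr associator_altm // scaler0 add0r -[_ *: hone H]addr0.
rewrite associatorPr associator1r scaler0 add0r.
by rewrite /associator !amulx0 subrr.
Qed.

Lemma peirce_projP x : peirce e (peirce_proj x).
Proof.
split; first by rewrite {1}peirce_proj_assoc idempotent_mul_e peirce_proj_assoc.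
have [e'0 e'1] := hconj_idempotent eI.
by rewrite /peirce_proj amulKr // e'0 e'1 scale1r scale0r subr0.
Qed.

Lemma peirce_proj_polar x y : peirce e' x -> B x (peirce_proj y) = B x y.
Proof.
move=> [e'x xe]; rewrite hconjK in xe.
rewrite hpolarC hpolar_adjr hconjK xe hpolar_adjl e'x.
by rewrite hpolarC.
Qed.

Lemma idempotent_mul_self x : e ** x ** e = B e (hconj x) *: e.
Proof.
have := amul_mid dimH e x (hone H).
by rewrite hmul1x hmulx1 eI.1 scale0r subr0.
Qed.

End PeirceProjection.

Section GradedSuperHurwitz.
Variables (F : fieldType) (H : hurwitz F) (M : 'Z_2 -> {vspace H}).
Hypothesis Mgr : is_grading M.
Hypothesis dimH : (1 < \dim {:H})%N.
Local Notation N := (@hnorm F H).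
Local Notation B := (@hpolar F H).
Local Notation T := (@htrace F H).
Local Notation one := (hone H).
Local Notation C := (Superalgebra Mgr).
Variables (G : zmodType) (Gamma : G -> {vspace H}).
Hypothesis sgr : @is_super_grading F C G Gamma.

Let grG : is_grading Gamma. Proof. by case: sgr. Qed.

Definition bihomogeneous g i (x : H) := x \in Gamma g /\ x \in M i.
Local Notation hom := bihomogeneous.

Lemma hom_mul g i h j x y : hom g i x -> hom h j y -> hom (g + h) (i + j) (x ** y).
Proof.
move=> [xg xi] [yh yj]; split; last exact: (super_mul Mgr).
by case: grG => _ _; apply.
Qed.

Lemma hom_conj g i x : hom g i x -> hom g i (hconj x).
Proof.
by move=> [xg xi]; split; [apply: (graded_conj grG)|apply: (super_conj Mgr)].
Qed.

Lemma homZ g i a x : hom g i x -> hom g i (a *: x).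
Proof. by move=> [xg xi]; split; rewrite memvZ. Qed.

Lemma hom1 : hom 0 0 one.
Proof. by split; [apply: (graded_one grG)|apply: even_one]. Qed.

Lemma hom_ex i (P : H -> Prop) x :
  P 0 -> (forall x y, P x -> P y -> P (x + y)) -> x \in M i -> ~ P x ->
  exists g y, hom g i y /\ ~ P y.
Proof.
move=> P0 PD xi nP.
have [g [y [yg yi nPy]]] := super_grading_ex sgr P0 PD xi nP.
by exists g, y.
Qed.

Lemma hom_ex_notin i (K : {vspace H}) : (\dim K < \dim (M i))%N ->
  exists g y, hom g i y /\ y \notin K.
Proof.
move=> dimK; have [x xi xK] : exists2 x, x \in M i & x \notin K.
  apply: NNPP => h; suff /dimvS : (M i <= K)%VS by rewrite leqNgt dimK.
  apply/subvP => x xi; apply/negP => /negP xK; apply: h.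
  by exists x.
have [||g [y [yh /negP yK]]] := @hom_ex i (fun x => x \in K) x _ _ xi (elimN idP xK).
- exact: mem0v.
- by move=> a b; apply: rpredD.
by exists g, y.
Qed.

Lemma hom_dual g i x : hom g i x -> x != 0 ->
  exists2 y, hom (- g) i y & B x y != 0.
Proof.
move=> [xg xi] x0.
have [y yi xy] : exists2 y, y \in M i & B x y <> 0.
  apply: NNPP => h; case/eqP: x0; apply: (hpolar_nondeg dimH).
  apply: (grading_ind Mgr) => [|a b ha hb|j y yj]; first exact: hpolar0r.
    by rewrite hpolarDr ha hb addr0.
  have [eij|eij] : j = i \/ j = 1 - i.
    have [->|->] := ord2_cases i; have [->|->] := ord2_cases j;
    by [left|right; apply: val_inj].
    apply: NNPP => xy; apply: h; exists y => //.
    by rewrite -eij.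
  by apply: (super_polar Mgr dimH xi); rewrite -eij.
have [||h [z [[zh zi] xz]]] := @hom_ex i (fun y => B x y = 0) y _ _ yi xy.
- exact: hpolar0r.
- by move=> a b ha hb; rewrite hpolarDr ha hb addr0.
exists z; last exact/eqP.
split=> //; suff -> : - g = h by [].
(* A homogeneous element that pairs nontrivially with x can only have the opposite degree. *)
apply/eqP; rewrite -subr_eq0 -opprD oppr_eq0; apply/negP => /negP gh.
by apply: xz; apply: (graded_polar grG dimH xg zh gh).
Qed.

Definition sector_isotropic := exists x, [/\ hom 0 0 x, x != 0 & N x = 0].

Lemma Z2_double (i : 'Z_2) : i + i = 0.
Proof. by have [->|->] := ord2_cases i; apply: val_inj. Qed.

(* Pairing an isotropic x with its dual y, the product x * conj y is isotropic
   of trace [B x y], so it is nonzero. *)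
Lemma isotropic_sector g i x : hom g i x -> x != 0 -> N x = 0 -> sector_isotropic.
Proof.
move=> xh x0 Nx; have [y yh xy] := hom_dual xh x0.
exists (x ** hconj y); split; last by rewrite hnormM Nx mul0r.
  by have := hom_mul xh (hom_conj yh); rewrite subrr Z2_double.
by apply: contraNneq xy => xy0; rewrite hpolarE_trace xy0 /htrace hpolar0l.
Qed.

Lemma sector_idempotent : sector_isotropic ->
  exists2 e, hom 0 0 e & hurwitz_idempotent e.
Proof.
move=> [x [xh x0 Nx]]; have [y yh xy] := hom_dual xh x0.
rewrite oppr0 in yh.
(* T (x ** hconj y) = B x y, so the scaling gives trace 1; the norm is 0 because N x = 0. *)
exists ((B x y)^-1 *: (x ** hconj y)).
  by apply: homZ; have := hom_mul xh (hom_conj yh); rewrite !addr0.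
split; first by rewrite hnormZ hnormM Nx mul0r mulr0.
by rewrite /htrace hpolarZl -/(T _) -hpolarE_trace mulVf.
Qed.

Section WithIdempotent.
Variable e : H.
Hypothesis eh : hom 0 0 e.
Hypothesis eI : hurwitz_idempotent e.
Local Notation e' := (hconj e).

Lemma hom_proj g i x : hom g i x -> hom g i (peirce_proj e x).
Proof.
move=> xh; have := hom_mul (hom_mul eh xh) (hom_conj eh).
by rewrite !add0r !addr0.
Qed.

(** Projecting a homogeneous dual of x to U changes neither its degree nor its pairing with x, since
    x lies in V. *)
Lemma peirce_dual g i x : hom g i x -> peirce e' x -> x != 0 ->
  exists y, [/\ hom (- g) i y, peirce e y & B x y = 1].
Proof.
move=> xh xV x0; have [y yh xy] := hom_dual xh x0.
exists ((B x y)^-1 *: peirce_proj e y); split.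
- exact/homZ/hom_proj.
- exact/peirceZ/peirce_projP.
- by rewrite hpolarZr peirce_proj_polar // mulVf.
Qed.

Lemma odd_even_comm a y : a \in M 0 -> y \in M 1 -> y ** a = hconj a ** y.
Proof.
move=> a0 y1; apply: (orthogonal_comm dimH (odd_trace Mgr dimH y1)).
exact: (odd_even_polar Mgr dimH y1).
Qed.

(** An odd element commutes past an even one up to conjugation, so e ** y ** hconj e = e ** (e **
    y). Applied to e and to hconj e, this puts the whole odd part in U + V. *)
Lemma odd_proj y : y \in M 1 -> peirce_proj e y = e ** y.
Proof.
move=> y1; have [_ e0] := eh; have [_ e'0] := hom_conj eh.
rewrite /peirce_proj (odd_even_comm e'0) ?hconjK ?idempotent_mul_e //.
by have := super_mul Mgr e0 y1; rewrite add0r.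
Qed.

End WithIdempotent.

(** The diagonal Peirce components of x lie in the span of e and hconj e, so one of the other two is
    nonzero. If only the one in V is, hconj e takes the place of e. *)
Lemma hom_peirce_ex e g i x : hom 0 0 e -> hurwitz_idempotent e ->
  hom g i x -> x \notin <<[:: e; hconj e]>>%VS ->
  exists e1 u, [/\ hom 0 0 e1, hurwitz_idempotent e1, hom g i u,
    peirce e1 u & u != 0].
Proof.
move=> eh eI xh xn; have e'I := hconj_idempotent eI.
have e'h := hom_conj eh.
have [p0|] := eqVneq (peirce_proj e x) 0; last first.
  by exists e, (peirce_proj e x); split=> //; [apply: hom_proj|apply: peirce_projP].
have [p'0|] := eqVneq (peirce_proj (hconj e) x) 0; last first.
  by exists (hconj e), (peirce_proj (hconj e) x); split=> //;
  [apply: hom_proj|apply: peirce_projP].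
case/negP: xn; rewrite -[x]hmul1x -[_ ** x]hmulx1 -(idempotent_sum eI).
rewrite amulDl (amulDl (e ** x)) !(amulDr e) -/(peirce_proj e x) p0 addr0.
rewrite /peirce_proj hconjK in p'0.
rewrite p'0 add0r !idempotent_mul_self // rpredD // memvZ //.
  by rewrite memv_span ?inE ?eqxx.
by rewrite memv_span ?inE ?eqxx ?orbT.
Qed.

Lemma rank1_frame_ex : (0 < \dim (M 1%R))%N -> sector_isotropic ->
  exists e u v g, [/\ hom 0 0 e, hom g 1 u, hom (- g) 1 v &
    peirce_frame e (fun _ : unit => u) (fun _ => v)].
Proof.
move=> M1 /sector_idempotent [e0 e0h e0I].
have [g [x [xh x0]]] : exists g x, hom g 1 x /\ x \notin 0%VS.
  by apply: hom_ex_notin; rewrite dimv0.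
have xn : x \notin <<[:: e0; hconj e0]>>%VS.
  apply: contra x0 => xs; rewrite -(super_cap Mgr); apply/memv_capP.
  split; last by case: xh.
  have [[_ e0M] [_ e0'M]] := (e0h, hom_conj e0h).
  by apply: subvP xs; apply/span_subvP => y; rewrite !inE => /orP[]/eqP->.
have [e [u [eh eI uh Uu u0]]] := hom_peirce_ex e0h e0I xh xn.
have [v [vh Vv uv]] : exists v, [/\ hom (- g) 1 v, peirce (hconj e) v & B u v = 1].
  apply: (peirce_dual (hom_conj eh) (hconj_idempotent eI) uh) => //.
  by rewrite hconjK.
exists e, u, v, g; split=> //; split=> // -[] []; rewrite eqxx.
Qed.

Lemma rank2_frame_ex : (2 < \dim (M 0%R))%N -> (0 < \dim (M 1%R))%N ->
  sector_isotropic -> exists e u1 u2 u3 g1 g2 g3,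
  [/\ hom 0 0 e /\ hurwitz_idempotent e, hom g1 1 u1 /\ peirce e u1,
      hom g2 1 u2 /\ peirce e u2, hom g3 0 u3 /\ peirce e u3
    & B (u1 ** u2) u3 = 1].
Proof.
move=> M0 M1 /sector_idempotent [e0 e0h e0I].
have [g3 [x [xh xn]]] : exists g x, hom g 0 x /\ x \notin <<[:: e0; hconj e0]>>%VS.
  by apply: hom_ex_notin; apply: leq_ltn_trans M0; apply: dim_span.
have [e [u3 [eh eI u3h Uu3 u30]]] := hom_peirce_ex e0h e0I xh xn.
have e'h := hom_conj eh; have e'I := hconj_idempotent eI.
have [v3 [v3h Vv3 uv3]] : exists v,
    [/\ hom (- g3) 0 v, peirce (hconj e) v & B u3 v = 1].
  by apply: (peirce_dual e'h e'I u3h) => //; rewrite hconjK.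
(* For odd nonzero z, polarization writes z as hconj u3 ** (v3 ** z) + hconj v3 ** (u3 ** z), so u3
   cannot annihilate both z and v3 ** z. *)
have [g1 [z [zh u3z]]] : exists g z, hom g 1 z /\ u3 ** z <> 0.
  have [z z1 z0] : exists2 z, z \in M 1 & z != 0.
    by exists (vpick (M 1)); rewrite ?memv_pick // vpick0 -dimv_eq0 -lt0n.
  have P0 : u3 ** 0 = 0 by apply: amulx0.
  have PD a b : u3 ** a = 0 -> u3 ** b = 0 -> u3 ** (a + b) = 0.
    by move=> hx hy; rewrite amulDr hx hy addr0.
  have [u3z|u3z] := eqVneq (u3 ** z) 0; last first.
    by apply: (hom_ex P0 PD z1); apply/eqP.
  have v3z : v3 ** z \in M 1 by have := super_mul Mgr v3h.2 z1; rewrite add0r.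
  apply: (hom_ex P0 PD v3z) => u3v3z; case/eqP: z0.
  have := hconj_mul_polarized dimH u3 z v3.
  by rewrite uv3 scale1r u3z amulx0 addr0 (peirce_hconj eI) // amulNl u3v3z oppr0.
pose u1 := peirce_proj e z.
have u1h : hom g1 1 u1 by apply: hom_proj.
have Uu1 : peirce e u1 by apply: peirce_projP.
(* z is u1 plus an odd element of V. The product of u3 with the latter is a multiple of B u3 (hconj
   e ** z), which vanishes by parity. *)
have u3u1 : u3 ** u1 <> 0.
  move=> h; apply: u3z; rewrite -[z]hmul1x -(idempotent_sum eI) amulDl amulDr.
  rewrite -(odd_proj eh eI zh.2) -/u1 h add0r -(odd_proj e'h e'I zh.2).
  have Vz := peirce_projP dimH e'I z.
  rewrite (peirceMV dimH eI Uu3 Vz) (super_polar Mgr dimH u3h.2).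
    by rewrite oppr0 scale0r.
  by rewrite subr0; have [] := hom_proj e'h zh.
(* u3 ** u1 is a nonzero element of V, so it has a dual u2 in U; cyclic symmetry turns this pairing
   into the required normalization. *)
have [||u2 [u2h Uu2 u312]] := peirce_dual eh eI (hom_mul u3h u1h).
- exact: peirceM.
- exact/eqP.
rewrite add0r in u2h.
exists e, u1, u2, u3, g1, (- (g3 + g1)), g3; split=> //.
by rewrite -(peirce_polar_cyclic dimH eI).
Qed.

Lemma anisotropic_sector_trace : exists2 w, hom 0 0 w & T w != 0.
Proof.
have [w wh tw] := hom_dual hom1 (hone_neq0 H); rewrite oppr0 in wh.
by exists w; rewrite // /htrace hpolarC.
Qed.

Lemma hom_quad_orthogonal w : T one = 0 -> hom 0 0 w -> T w != 0 ->
  (2 < \dim (M 0%R))%N ->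
  exists g v, [/\ hom g 0 v, v != 0, T v = 0 & B v w = 0].
Proof.
move=> T1 wh Tw M0.
have [|g [x [xh xK]]] := @hom_ex_notin 0 (quadratic_subalgebra w).
  by rewrite quad_dim.
(* Now 1 and w are both self-orthogonal, so the coefficient of p at each is read off by pairing with
   the other. *)
have Bww : B w w = 0.
  by rewrite hpolarxx -mulr_natr -(htrace1 H) T1 mulr0.
(* p is the orthogonal projection of x onto the span of 1 and w. *)
pose p := (B x w / T w) *: one + (T x / T w) *: w.
have pK : p \in quadratic_subalgebra w.
  by apply/quadP; exists (B x w / T w), (T x / T w).
have Tp : T p = T x.
  by rewrite /htrace hpolarDl !hpolarZl -!/(T _) T1 mulr0 add0r divfK.
have Bp : B p w = B x w.
  by rewrite hpolarDl !hpolarZl Bww mulr0 addr0 (hpolarC one) divfK.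
(* For g nonzero, x is already orthogonal to 1 and w, so p = 0; subtracting p therefore keeps the
   degree g. *)
have ph : hom g 0 p.
  have [->|g0] := eqVneq g 0.
    have [[o0 oM] [w0 wM]] := (hom1, wh).
    by split; rewrite rpredD // memvZ.
  suff -> : p = 0 by split; apply: mem0v.
  rewrite /p; have -> : T x = 0 by apply: (graded_trace grG dimH xh.1 g0).
  rewrite (graded_polar grG dimH xh.1 wh.1) ?addr0 //.
  by rewrite !mul0r !scale0r addr0.
have [[xg xM] [pg pM]] := (xh, ph).
exists g, (x - p); split.
- by split; rewrite rpredB.
- by apply: contraNneq xK => /eqP; rewrite subr_eq0 => /eqP ->.
- by rewrite /htrace hpolarBl -!/(T _) Tp subrr.
- by rewrite hpolarBl Bp subrr.
Qed.

(** * The four cases *)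

Section Classification.
Hypothesis fineG : @is_fine_grading F C G Gamma.
Hypothesis univG : universal_grading_group Gamma.

Lemma fine_main : \dim (M 0%R) = 2%N -> \dim (M 1%R) = 2%N -> T one = 0 ->
  ~ sector_isotropic ->
  @up_to_equivalence F C G Gamma 'Z_2 (fun Gamma' =>
    ~ split_on N (M 0) /\ forall i, Gamma' i = M i).
Proof.
move=> dimM0 dimM1 T1 aniso.
have niso g i x : hom g i x -> x != 0 -> N x != 0.
  by move=> xh x0; apply/eqP => Nx; apply/aniso/(isotropic_sector xh x0 Nx).
have [w wh Tw] := anisotropic_sector_trace.
(* The plane K fills the two-dimensional even part, so [Gamma] cannot split it. *)
have M0G : (M 0%R <= Gamma 0%R)%VS.
  have -> : M 0 = quadratic_subalgebra w.
    apply/esym/eqP; rewrite eqEdim quad_dim // dimM0 leqnn andbT.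
    by apply: (quad_sub Mgr wh.2).
  by rewrite subv_add -!memvE wh.1 (graded_one grG).
have [|g [u [uh u0]]] := @hom_ex_notin 1 0%VS; first by rewrite dimv0 dimM1.
rewrite memv0 in u0.
have Mu : mulv_elt (M 0) u = M 1.
  apply: (odd_mulv_elt Mgr dimH uh.2 (niso _ _ _ uh u0)).
  by rewrite dimM0 dimM1.
apply: (fine_up_to_equivalence sgr fineG univG (Delta := M)).
- split=> // i; apply/eqP; rewrite eqEsubv subv_add !capvSl !andbT /=.
  have [->|->] := ord2_cases i; rewrite capvv; [exact: addvSl|exact: addvSr].
- apply: (nonisotropic_universal Mgr) => i.
  have [->|->] := ord2_cases i.
    by exists one; rewrite ?hnorm1 ?oner_eq0 //; case: hom1.
  by exists u; [case: uh|apply: niso uh u0].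
- move=> i; have [->|->] := ord2_cases i; first by exists 0.
  exists (0 + g); rewrite -Mu; apply/subvP => _ /mulv_eltP[k /(subvP M0G) kG ->].
  by case: grG => _ _; apply=> //; case: uh.
split=> // -[x [x0 xn Nx]]; apply: aniso; exists x; split=> //; split=> //.
exact: subvP x0.
Qed.

Lemma fine_3grading : \dim (M 0%R) = 2%N -> \dim (M 1%R) = 2%N ->
  sector_isotropic ->
  @up_to_equivalence F C G Gamma int (fun Gamma' =>
    split_on N (M 0) /\
    exists e1 e2 u1 v1 : H,
      [/\ canonical_quaternion_basis e1 e2 u1 v1,
          forall x, x \in [:: e1; e2; u1; v1] -> homogeneous Gamma' x,
          (Gamma' 0%R :&: M 0%R)%VS = M 0 /\ M 0 = <<[:: e1; e2]>>%VS,
          (Gamma' 1%R :&: M 1%R)%VS = <[u1]>%VS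
        & (Gamma' (-1)%R :&: M 1%R)%VS = <[v1]>%VS]).
Proof.
move=> dimM0 dimM1 iso.
have [|e [u [v [g [eh uh vh fr]]]]] := rank1_frame_ex _ iso; first by rewrite dimM1.
have dim4 : \dim {:H} = 4%N by rewrite -(super_dim Mgr) dimM0 dimM1.
have [eI _ _ _] := fr.
have e'h := hom_conj eh.
have gr := rank1_grading dim4 fr.
have [sup sec] := @frame_super _ _ _ Mgr _ _ _ _ _ degree1 (fun=> 1)
  degree1_inj gr eh.2 e'h.2 (fun=> uh.2) (fun=> vh.2).
have M0E : M 0 = <<[:: e; hconj e]>>%VS.
  apply/esym/eqP; rewrite eqEdim dimM0; apply/andP; split.
    by apply/span_subvP => x; rewrite !inE => /orP[]/eqP->; [case: eh|case: e'h].
  have := frame_free dimH fr (s := [::]) isT.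
  by move=> /eqP /= ->.
apply: (fine_up_to_equivalence sgr fineG univG (Delta := frame_grading e _ _ degree1)).
- exact: sup.
- exact: rank1_universal.
- apply: (frame_refines degree1_inj) => [||_|_].
  + by case: eh.
  + by case: e'h.
  + by exists g; case: uh.
  + by exists (- g); case: vh.
split.
  exists e; split; [by case: eh| |by case: eI].
  by have [] := frame_neq0 fr.
have gE := frame_gradingE e (fun=> u) (fun=> v) degree1_inj.
exists e, (hconj e), u, v; split.
- exact: (rank1_canonical dim4 fr).
- move=> x; rewrite !inE => /or4P[] /eqP ->.
  + by exists 0; rewrite (gE None) memv_span ?inE ?eqxx.
  + by exists 0; rewrite (gE None) memv_span ?inE ?eqxx ?orbT.
  + by exists 1; rewrite (gE (Some (true, tt))) memv_line.
  + by exists (-1); rewrite (gE (Some (false, tt))) memv_line.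
- by split=> //; rewrite [RHS]M0E; apply: (sec None).
- exact: (sec (Some (true, tt))).
- exact: (sec (Some (false, tt))).
Qed.

Lemma fine_quarter : \dim (M 0%R) = 4%N -> \dim (M 1%R) = 4%N -> T one = 0 ->
  ~ sector_isotropic ->
  @up_to_equivalence F C G Gamma ('Z_2 * 'Z_2)%type (fun Gamma' =>
    let K := (Gamma' (0%R, 0%R) :&: M 0%R)%VS in
    [/\ ~ split_on N K, regular_on N K, refines Gamma' M
      & exists u v w : H,
        [/\ [/\ is_nonisotropic N u, is_nonisotropic N v & is_nonisotropic N w],
            [/\ polar_orthogonal N u v, polar_orthogonal N u w
              & polar_orthogonal N v w],
            polar N u one = 0 /\ polar N v one = 0,
            [/\ directv (M 0%R + mulv_elt (M 0%R) u)
                  /\ (M 0%R + mulv_elt (M 0%R) u)%VS = fullv,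
                directv (K + mulv_elt K v) /\ (K + mulv_elt K v)%VS = M 0
              & directv (<[one]> + <[w]>) /\ (<[one]> + <[w]>)%VS = K]
          & [/\ (Gamma' (1%R, 0%R) :&: M 0%R)%VS = mulv_elt K v,
                (Gamma' (0%R, 1%R) :&: M 1%R)%VS = mulv_elt K u
              & (Gamma' (1%R, 1%R) :&: M 1%R)%VS = mulv_elt K (v ** u)]]]).
Proof.
move=> dimM0 dimM1 T1 aniso.
have niso g i x : hom g i x -> x != 0 -> N x != 0.
  by move=> xh x0; apply/eqP => Nx; apply/aniso/(isotropic_sector xh x0 Nx).
have [w wh Tw] := anisotropic_sector_trace.
have [|gv [v [vh v0 Tv vw]]] := hom_quad_orthogonal T1 wh Tw; first by rewrite dimM0.
have [|gu [u [uh u0]]] := @hom_ex_notin 1 0%VS; first by rewrite dimv0 dimM1.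
rewrite memv0 in u0.
have w0 : w != 0 by apply: contraNneq Tw => ->; rewrite /htrace hpolar0l.
have Nu := niso _ _ _ uh u0; have Nv := niso _ _ _ vh v0.
have Nw := niso _ _ _ wh w0.
have [[wG wM] [vG vM] [uG uM]] := And3 wh vh uh.
have KG : (quadratic_subalgebra w <= Gamma 0%R)%VS.
  by rewrite subv_add -!memvE wG (graded_one grG).
have KM := quad_sub Mgr wM.
apply: (fine_up_to_equivalence sgr fineG univG (Delta := quarter_grading w v u)).
- exact: quarter_super.
- exact: (quarter_universal Mgr).
- exact: (quarter_refines grG wG vG uG).
have sec i j := @quarter_sector _ _ _ Mgr dimH w v u dimM0 T1 wM vM uM Tw vw Tv Nv i j.
have -> : (quarter_grading w v u (0%R, 0%R) :&: M 0%R)%VS = quadratic_subalgebra w.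
  exact: sec.
split.
- move=> [x [xK x0 Nx]]; apply: aniso; exists x; split=> //.
  by split; [apply: subvP KG _ xK|apply: subvP KM _ xK].
- have rad x : polar_radical N (quadratic_subalgebra w) x -> x = 0.
    by case=> xK; apply: (quad_radical T1 Tw).
  by split=> [x /rad ->|x y /rad ->]; rewrite eqxx.
- move=> [i j]; exists j; rewrite quarter_gradingE.
  exact: (quarter_sub (M := M)).
exists u, v, w; split=> //.
- by split=> //; [apply: (odd_even_polar Mgr)|apply: (odd_even_polar Mgr)].
- by split=> //; apply: (odd_trace Mgr).
- have uM1 : mulv_elt (M 0) u = M 1.
    by apply: (odd_mulv_elt Mgr) => //; rewrite dimM0 dimM1.
  split; first rewrite uM1.
  + split; last exact: (super_sum Mgr).
    by rewrite directv_addE !directv_trivial /= (super_cap Mgr).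
  + split; last exact: (quad_v_sum Mgr).
    by rewrite directv_addE !directv_trivial /= quad_v_cap.
  + by split=> //; apply: quad_direct.
split; first exact: sec.
  exact: sec.
by rewrite sec -(quarter11 Mgr dimH wM vM uM vw Tv).
Qed.

Lemma fine_cartan : \dim (M 0%R) = 4%N -> \dim (M 1%R) = 4%N ->
  sector_isotropic ->
  @up_to_equivalence F C G Gamma (int * int)%type (fun Gamma' =>
    split_on N (M 0) /\
    exists (e1 e2 : H) (u v : 'Z_3 -> H),
      [/\ [/\ canonical_cayley_basis e1 e2 u v,
              homogeneous Gamma' e1 /\ homogeneous Gamma' e2
            & forall i, homogeneous Gamma' (u i) /\ homogeneous Gamma' (v i)],
          M 0 = <<[:: e1; e2; u 3%R; v 3%R]>>%VS
            /\ M 1 = <<[:: u 1%R; u 2%R; v 1%R; v 2%R]>>%VS,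
          [/\ (Gamma' (0%R, 0%R) :&: M 0%R)%VS = <<[:: e1; e2]>>%VS,
              (Gamma' (1%R, 1%R) :&: M 0%R)%VS = <[v 3%R]>%VS
            & (Gamma' ((-1)%R, (-1)%R) :&: M 0%R)%VS = <[u 3%R]>%VS]
        & [/\ (Gamma' (1%R, 0%R) :&: M 1%R)%VS = <[u 1%R]>%VS,
              (Gamma' ((-1)%R, 0%R) :&: M 1%R)%VS = <[v 1%R]>%VS,
              (Gamma' (0%R, 1%R) :&: M 1%R)%VS = <[u 2%R]>%VS
            & (Gamma' (0%R, (-1)%R) :&: M 1%R)%VS = <[v 2%R]>%VS]]).
Proof.
move=> dimM0 dimM1 iso; have dim8 : \dim {:H} = 8%N.
  by rewrite -(super_dim Mgr) dimM0 dimM1.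
have [||e [u1 [u2 [u3 [g1 [g2 [g3]]]]]]] := rank2_frame_ex _ _ iso.
- by rewrite dimM0.
- by rewrite dimM1.
move=> [[eh eI] [u1h Uu1] [u2h Uu2] [u3h Uu3] u123].
have e'h := hom_conj eh.
pose u (i : 'Z_3) := if i == 1 then u1 else if i == 2%:R then u2 else u3.
pose g (i : 'Z_3) := if i == 1 then g1 else if i == 2%:R then g2 else g3.
pose s (i : 'Z_3) : 'Z_2 := if i == 3%:R then 0 else 1.
have Uu i : peirce e (u i) by rewrite /u; do 2 case: ifP => _ //.
have uh i : hom (g i) (s i) (u i) by have [->|->|->] := ord3_cases i.
(* The parities 1, 1, 0 of the three u's sum to 0, so [cross u i] has the parity of [u i]. *)
have s_add i : s (i + 1) + s (i + 2%:R) = s i.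
  by have [->|->|->] := ord3_cases i; apply: val_inj.
have vh i : hom (g (i + 1) + g (i + 2%:R)) (s i) (cross u i).
  by rewrite -s_add; apply: hom_mul.
have fr := cross_frame dim8 eI Uu u123.
have gr := rank2_grading dim8 eI Uu u123.
have [sup sec] := @frame_super _ _ _ Mgr _ _ _ _ _ degree2 s
  degree2_inj gr eh.2 e'h.2 (fun i => (uh i).2) (fun i => (vh i).2).
have gE := frame_gradingE e u (cross u) degree2_inj.
have M0E : M 0 = <<[:: e; hconj e; u 3%:R; cross u 3%:R]>>%VS.
  apply/esym/eqP; rewrite eqEdim dimM0; apply/andP; split.
    apply/span_subvP => x; rewrite !inE => /or4P[]/eqP->.
    - by case: eh.
    - by case: e'h.
    - by case: (uh 3%:R).
    - by case: (vh 3%:R).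
  have := frame_free dimH fr (s := [:: 3%:R]) isT.
  by move=> /eqP /= ->.
have M1E : M 1 = <<[:: u 1; u 2%:R; cross u 1; cross u 2%:R]>>%VS.
  apply/esym/eqP; rewrite eqEdim dimM1; apply/andP; split.
    apply/span_subvP => x; rewrite !inE => /or4P[]/eqP->.
    - by case: (uh 1).
    - by case: (uh 2%:R).
    - by case: (vh 1).
    - by case: (vh 2%:R).
  have := frame_free dimH fr (s := [:: 1; 2%:R]) isT.
  by move/(catr_free (X := [:: e; hconj e])) => /eqP /= ->.
apply: (fine_up_to_equivalence sgr fineG univG
  (Delta := frame_grading e u (cross u) degree2)).
- exact: sup.
- exact: (rank2_universal dim8 eI Uu u123).
- apply: (frame_refines degree2_inj) => [||i|i].
  + by case: eh.
  + by case: e'h.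
  + by exists (g i); case: (uh i).
  + by eexists; case: (vh i) => + _; apply.
split.
  exists e; split; [by case: eh| |by case: eI].
  by have [] := frame_neq0 fr.
exists e, (hconj e), u, (cross u); split.
- split; first exact: (cross_canonical dim8 eI Uu u123).
    by split; exists 0; rewrite (gE None) memv_span ?inE ?eqxx ?orbT.
  move=> i; split; first by exists (degree2 i); rewrite (gE (Some (true, i))) memv_line.
  by exists (- degree2 i); rewrite (gE (Some (false, i))) memv_line.
- by [].
- split; first exact: (sec None).
    exact: (sec (Some (false, 3%:R))).
  exact: (sec (Some (true, 3%:R))).
split; first exact: (sec (Some (true, 1))).
- exact: (sec (Some (false, 1))).
- exact: (sec (Some (true, 2%:R))).
- exact: (sec (Some (false, 2%:R))).
Qed.

End Classification.

End GradedSuperHurwitz.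

(** * Application to the Cayley-Dickson superalgebra *)

Lemma dim_cd_main (F : fieldType) (Q : hurwitz F) (alpha : F) i :
  \dim (cd_main Q alpha i) = \dim {:Q}.
Proof.
have dimQQ : \dim {: (Q * Q)%type} = (\dim {:Q} + \dim {:Q})%N.
  by rewrite !dimvf.
rewrite /cd_main; case: ifP => _; apply/eqP.
  rewrite -(eqn_add2r (\dim {:Q})) -dimQQ.
  rewrite -(limg_ker_dim (linfun (@snd Q Q)) fullv) capfv; apply/eqP.
  congr (_ + \dim _)%N; apply/vspaceP => x; rewrite memvf; apply/esym/memv_imgP.
  by exists (0, x); rewrite ?memvf // lfunE.
rewrite -(eqn_add2r (\dim {:Q})) -dimQQ.
rewrite -(limg_ker_dim (linfun (@fst Q Q)) fullv) capfv; apply/eqP.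
congr (_ + \dim _)%N; apply/vspaceP => x; rewrite memvf; apply/esym/memv_imgP.
by exists (x, 0); rewrite ?memvf // lfunE.
Qed.

Theorem theorem18 (F : fieldType) (charF2 : 2%N \in [pchar F])
  (Q : hurwitz F) (dimQ : \dim {:Q} = 2%N \/ \dim {:Q} = 4%N)
  (alpha : F) (alpha_neq0 : alpha != 0)
  (G : zmodType) (Gamma : G -> {vspace CD Q alpha})
  (Gamma_fine : is_fine_grading Gamma)
  (Gamma_univ : universal_grading_group Gamma) :
  let C := CD Q alpha in
  let C0 := even_part C in
  let C1 := odd_part C in
  let q := @cd_norm F Q alpha in
  let one := cd_one Q alpha in
  (\dim {:Q} = 2%N ->
     up_to_equivalence Gamma (fun Gamma' : 'Z_2 -> {vspace C} =>
       ~ split_on q C0 /\ forall i : 'Z_2, Gamma' i = main C i)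
     \/
     up_to_equivalence Gamma (fun Gamma' : int -> {vspace C} =>
       split_on q C0 /\
       exists e1 e2 u1 v1 : C,
         [/\ canonical_quaternion_basis e1 e2 u1 v1,
             forall x, x \in [:: e1; e2; u1; v1] -> homogeneous Gamma' x,
             (Gamma' 0%R :&: C0)%VS = C0 /\ C0 = <<[:: e1; e2]>>%VS,
             (Gamma' 1%R :&: C1)%VS = <[u1]>%VS
           & (Gamma' (-1)%R :&: C1)%VS = <[v1]>%VS]))
  /\
  (\dim {:Q} = 4%N ->
     up_to_equivalence Gamma (fun Gamma' : 'Z_2 * 'Z_2 -> {vspace C} =>
       let K := (Gamma' (0%R, 0%R) :&: C0)%VS in
       [/\ ~ split_on q K,
           regular_on q K,
           refines Gamma' (main C)
         & exists u v w : C,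
           [/\ [/\ is_nonisotropic q u, is_nonisotropic q v & is_nonisotropic q w],
               [/\ polar_orthogonal q u v, polar_orthogonal q u w & polar_orthogonal q v w],
               polar q u one = 0 /\ polar q v one = 0,
               [/\ directv (C0 + mulv_elt C0 u)
                     /\ (C0 + mulv_elt C0 u)%VS = fullv,
                   directv (K + mulv_elt K v) /\ (K + mulv_elt K v)%VS = C0
                 & directv (<[one]> + <[w]>) /\ (<[one]> + <[w]>)%VS = K]
             & [/\ (Gamma' (1%R, 0%R) :&: C0)%VS = mulv_elt K v,
                   (Gamma' (0%R, 1%R) :&: C1)%VS = mulv_elt K u
                 & (Gamma' (1%R, 1%R) :&: C1)%VS = mulv_elt K (v ** u)]]])
     \/
     up_to_equivalence Gamma (fun Gamma' : int * int -> {vspace C} =>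
       split_on q C0 /\
       exists (e1 e2 : C) (u v : 'Z_3 -> C),
         [/\ [/\ canonical_cayley_basis e1 e2 u v,
                 homogeneous Gamma' e1 /\ homogeneous Gamma' e2
               & forall i, homogeneous Gamma' (u i) /\ homogeneous Gamma' (v i)],
             C0 = <<[:: e1; e2; u 3%R; v 3%R]>>%VS
               /\ C1 = <<[:: u 1%R; u 2%R; v 1%R; v 2%R]>>%VS,
             [/\ (Gamma' (0%R, 0%R) :&: C0)%VS = <<[:: e1; e2]>>%VS,
                 (Gamma' (1%R, 1%R) :&: C0)%VS = <[v 3%R]>%VS
               & (Gamma' ((-1)%R, (-1)%R) :&: C0)%VS = <[u 3%R]>%VS]
           & [/\ (Gamma' (1%R, 0%R) :&: C1)%VS = <[u 1%R]>%VS,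
                 (Gamma' ((-1)%R, 0%R) :&: C1)%VS = <[v 1%R]>%VS,
                 (Gamma' (0%R, 1%R) :&: C1)%VS = <[u 2%R]>%VS
               & (Gamma' (0%R, (-1)%R) :&: C1)%VS = <[v 2%R]>%VS]])).
Proof.
have dimQ1 : (1 < \dim {:Q})%N by case: dimQ => ->.
have dimQ4 : (\dim {:Q} <= 4)%N by case: dimQ => ->.
pose H := cd_hurwitz alpha_neq0 dimQ1 dimQ4.
have Mgr : is_grading (cd_main Q alpha : 'Z_2 -> {vspace H}).
  exact: cd_main_grading.
have dM i : \dim (cd_main Q alpha i : {vspace H}) = \dim {:Q}.
  exact: dim_cd_main.
have dimH : (1 < \dim {:H})%N.
  by rewrite -(super_dim Mgr) !dM; case: dimQ => ->.
(* Characteristic 2 enters here. *)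
have T1 : htrace (hone H) = 0 by rewrite htrace1 pcharf0.
have [sgr _] := Gamma_fine.
split=> dimQE; rewrite -(dM 0) in dimQE; have dM1 := etrans (dM 1) (esym (dM 0)).
  rewrite dimQE in dM1.
  (* Existence of an isotropic vector is not decidable over an arbitrary field, hence the excluded
     middle. *)
  have [iso|aniso] := classic (@sector_isotropic F H (cd_main Q alpha) G Gamma).
    by right; apply: (@fine_3grading F H _ (cd_main_grading Q alpha) dimH G Gamma sgr).
  by left; apply: (@fine_main F H _ (cd_main_grading Q alpha) dimH G Gamma sgr).
rewrite dimQE in dM1.
have [iso|aniso] := classic (@sector_isotropic F H (cd_main Q alpha) G Gamma).
  by right; apply: (@fine_cartan F H _ (cd_main_grading Q alpha) dimH G Gamma sgr).
by left; apply: (@fine_quarter F H _ (cd_main_grading Q alpha) dimH G Gamma sgr).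
Qed.
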